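(* There are identifications (isomorphisms) of operads $$\mathcal{P}reLie\bullet\mathcal{C}om=\mathcal{Z}inb,\qquad \mathcal{P}reLie\bullet\mathcal{A}s=\mathcal{D}end,\qquad \mathcal{P}erm\circ\mathcal{L}ie=\mathcal{L}eib,$$ where $\bullet$ and $\circ$ are the black and white products of binary quadratic operads.
   Context: The ground field $k$ has characteristic $0$. For a finite dimensional right $\mathbb{S}_2$-module $V$ (an $\mathbb{S}$-module concentrated in arity $2$), $\mathcal{F}(V)$ is the free operad; $\mathcal{F}(V)(3)$ is the direct sum of three copies of $V\otimes V$ spanned by $\mu\circ_{\mathrm I}\nu=\mu(\nu(x,y),z)$, $\mu\circ_{\mathrm{II}}\nu=\mu(\nu(y,z),x)$, $\mu\circ_{\mathrm{III}}\nu=\mu(\nu(z,x),y)$. A binary quadratic operad is $\mathcal{F}(V)/(R)$ with $R\subset\mathcal{F}(V)(3)$ a sub-$\mathbb{S}_3$-module. Let $\mathcal{P}=\mathcal{F}(V)/(R)$, $\mathcal{Q}=\mathcal{F}(W)/(S)$. White product: $\mathcal{P}\circ\mathcal{Q}=\mathcal{F}(V\otimes W)/\big(\Phi^{-1}(R\otimes\mathcal{F}(W)(3)+\mathcal{F}(V)(3)\otimes S)\big)$ with $\Phi((\mu\otimes\mu')\circ_\alpha(\nu\otimes\nu'))=(\mu\circ_\alpha\nu)\otimes(\mu'\circ_\alpha\nu')$. Black product: $\mathcal{P}\bullet\mathcal{Q}=\mathcal{F}(V\otimes W\otimes k\cdot\mathrm{sgn}_{\mathbb{S}_2})/(\Psi(R\otimes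 S))$ with $\Psi((\mu\circ_\alpha\nu)\otimes(\mu'\circ_\beta\nu'))=\delta_{\alpha\beta}(\mu\otimes\mu'\otimes1)\circ_\alpha(\nu\otimes\nu'\otimes1)$. The operads are the binary quadratic operads encoding the following algebras: - $\mathcal{A}s$: (non-unital) associative algebras; $\mathcal{C}om$: commutative associative algebras; $\mathcal{L}ie$: Lie algebras. - $\mathcal{P}reLie$ (right preLie): $(xy)z-x(yz)=(xz)y-x(zy)$. - $\mathcal{P}erm$: $(xy)z=x(yz)=x(zy)$. - $\mathcal{Z}inb$ (Zinbiel): $(x\star y)\star z=x\star(y\star z)+x\star(z\star y)$. - $\mathcal{D}end$ (dendriform): two operations $\prec,\succ$ with $(x\prec y)\prec z=x\prec(y\prec z)+x\prec(y\succ z)$, $(x\succ y)\prec z=x\succ(y\prec z)$, $(x\prec y)\succ z+(x\succ y)\succ z=x\succ(y\succ z)$. - $\mathcal{L}eib$ (Leibniz): $[x,[y,z]]=[[x,y],z]-[[x,z],y]$. Operations without stated symmetry generate the regular representation of $\mathbb{S}_2$. *)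

(* Defs.v *)
From HB Require Import structures.
From mathcomp Require Import all_boot all_order all_fingroup all_algebra.
From mathcomp Require Import generic_quotient boolp.

Set Implicit Arguments.
Unset Strict Implicit.
Unset Printing Implicit Defensive.

Import GRing.Theory.
Local Open Scope quotient_scope.
Local Open Scope ring_scope.

(* An element [p] of arity [n] is thought of as a multilinear operation
   p(x_0, ..., x_(n-1)).  The right action renames variables:
     (p . s)(x_0, ..., x_(n-1)) = p(x_(s 0), ..., x_(s (n-1))),
   a right action for the product of ['S_n], where [(s * t) i = t (s i)].
   The partial composite [circ _ i p q] plugs [q] into slot [i] of [p]: the
   variable [k] of [q] becomes [i + k] and the variable [j != i] of [p] becomes
   [outer i n j].  To avoid transports between [P a] and [P b] for equal [a] and
   [b], [circ] takes its output arity [r] as an argument, with a proof that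
   [m + n = r.+1]. *)
Definition outer (i n j : nat) : nat :=
  (if j < i then j else (j + n).-1)%N.

(* [r] is the permutation of the variables of a composite p o_i q induced by
   the permutations [s] of the variables of [p] and [t] of those of [q]. *)
Definition block_perm (m n a : nat) (i : 'I_m) (s : 'S_m) (t : 'S_n)
    (r : 'S_a) : Prop :=
  (forall (j : 'I_m) (h : 'I_a), j != i -> h = outer i n j :> nat ->
     r h = outer (s i) n (s j) :> nat) /\
  (forall (l : 'I_n) (h : 'I_a), h = (i + l)%N :> nat ->
     r h = (s i + t l)%N :> nat).

Record operad (k : fieldType) := Operad {
  opd :> nat -> lmodType k;
  act : forall n, opd n -> 'S_n -> opd n;
  one : opd 1%N;
  circ : forall m n r, (m + n = r.+1)%N -> 'I_m -> opd m -> opd n -> opd r;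
  act_linear : forall n (s : 'S_n), linear (fun p => act p s);
  act1 : forall n (p : opd n), act p 1%g = p;
  actM : forall n (p : opd n) (s t : 'S_n), act p (s * t)%g = act (act p s) t;
  circ_linearl : forall m n r (e : (m + n = r.+1)%N) (i : 'I_m) (q : opd n),
    linear (fun p => circ e i p q);
  circ_linearr : forall m n r (e : (m + n = r.+1)%N) (i : 'I_m) (p : opd m),
    linear (circ e i p);
  circ1l : forall n (e : (1 + n = n.+1)%N) (i : 'I_1) (p : opd n),
    circ e i one p = p;
  circ1r : forall n (e : (n + 1 = n.+1)%N) (i : 'I_n) (p : opd n),
    circ e i p one = p;
  circ_seq : forall m n l a b t
      (e1 : (m + n = a.+1)%N) (e2 : (a + l = t.+1)%N)
      (e3 : (n + l = b.+1)%N) (e4 : (m + b = t.+1)%N)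
      (i : 'I_m) (j : 'I_n) (h : 'I_a) (p : opd m) (q : opd n) (r : opd l),
    h = (i + j)%N :> nat ->
    circ e2 h (circ e1 i p q) r = circ e4 i p (circ e3 j q r);
  circ_par : forall m n l a b t
      (e1 : (m + n = a.+1)%N) (e2 : (a + l = t.+1)%N)
      (e3 : (m + l = b.+1)%N) (e4 : (b + n = t.+1)%N)
      (i j : 'I_m) (j' : 'I_a) (i' : 'I_b) (p : opd m) (q : opd n) (r : opd l),
    (i < j)%N -> j' = outer i n j :> nat -> i' = i :> nat ->
    circ e2 j' (circ e1 i p q) r = circ e4 i' (circ e3 j p r) q;
  circ_act : forall m n a (e : (m + n = a.+1)%N) (i : 'I_m)
      (s : 'S_m) (t : 'S_n) (r : 'S_a) (p : opd m) (q : opd n),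
    block_perm i s t r ->
    circ e (s i) (act p s) (act q t) = act (circ e i p q) r
}.

Arguments act : simpl never.
Arguments one : simpl never.
Arguments circ : simpl never.

Record operad_morphism (k : fieldType) (P Q : operad k)
    (f : forall n, P n -> Q n) : Prop := OperadMorphism {
  mor_linear : forall n, linear (f n);
  mor_act : forall n (p : P n) s, f n (act p s) = act (f n p) s;
  mor_one : f 1%N (one P) = one Q;
  mor_circ : forall m n r (e : (m + n = r.+1)%N) i (p : P m) (q : P n),
    f r (circ e i p q) = circ e i (f m p) (f n q)
}.

Definition operad_iso (k : fieldType) (P Q : operad k) : Prop :=
  exists2 f : forall n, P n -> Q n, operad_morphism f & forall n, bijective (f n).

(* An operad up to an equivalence relation [peq], with classical quotients taken
   afterwards: both the free operad and the quotient of an operad by an ideal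
   are obtained in this way. *)
Record preoperad (k : fieldType) := PreOperad {
  pre :> nat -> Type;
  peq : forall n, pre n -> pre n -> Prop;
  pzero : forall n, pre n;
  padd : forall n, pre n -> pre n -> pre n;
  pscale : forall n, k -> pre n -> pre n;
  pact : forall n, pre n -> 'S_n -> pre n;
  pone : pre 1%N;
  pcirc : forall m n r, (m + n = r.+1)%N -> 'I_m -> pre m -> pre n -> pre r;
  peq_refl : forall n (p : pre n), peq p p;
  peq_sym : forall n (p q : pre n), peq p q -> peq q p;
  peq_trans : forall n (p q r : pre n), peq p q -> peq q r -> peq p r;
  padd_eq : forall n (p p' q q' : pre n),
    peq p p' -> peq q q' -> peq (padd p q) (padd p' q');
  pscale_eq : forall n a (p p' : pre n),
    peq p p' -> peq (pscale a p) (pscale a p');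
  pact_eq : forall n (p p' : pre n) s, peq p p' -> peq (pact p s) (pact p' s);
  pcirc_eq : forall m n r (e : (m + n = r.+1)%N) i (p p' : pre m) (q q' : pre n),
    peq p p' -> peq q q' -> peq (pcirc e i p q) (pcirc e i p' q');
  paddA : forall n (p q r : pre n),
    peq (padd p (padd q r)) (padd (padd p q) r);
  paddC : forall n (p q : pre n), peq (padd p q) (padd q p);
  padd0 : forall n (p : pre n), peq (padd (pzero n) p) p;
  paddN : forall n (p : pre n), peq (padd (pscale (-1) p) p) (pzero n);
  pscaleA : forall n a b (p : pre n),
    peq (pscale a (pscale b p)) (pscale (a * b) p);
  pscale1 : forall n (p : pre n), peq (pscale 1 p) p;
  pscaleDr : forall n a (p q : pre n),
    peq (pscale a (padd p q)) (padd (pscale a p) (pscale a q));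
  pscaleDl : forall n (p : pre n) a b,
    peq (pscale (a + b) p) (padd (pscale a p) (pscale b p));
  pact_linear : forall n (s : 'S_n) a (p q : pre n),
    peq (pact (padd (pscale a p) q) s) (padd (pscale a (pact p s)) (pact q s));
  pact1 : forall n (p : pre n), peq (pact p 1%g) p;
  pactM : forall n (p : pre n) (s t : 'S_n),
    peq (pact p (s * t)%g) (pact (pact p s) t);
  pcirc_linearl : forall m n r (e : (m + n = r.+1)%N) (i : 'I_m) (q : pre n)
      a (p p' : pre m),
    peq (pcirc e i (padd (pscale a p) p') q)
        (padd (pscale a (pcirc e i p q)) (pcirc e i p' q));
  pcirc_linearr : forall m n r (e : (m + n = r.+1)%N) (i : 'I_m) (p : pre m)
      a (q q' : pre n),
    peq (pcirc e i p (padd (pscale a q) q'))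
        (padd (pscale a (pcirc e i p q)) (pcirc e i p q'));
  pcirc1l : forall n (e : (1 + n = n.+1)%N) (i : 'I_1) (p : pre n),
    peq (pcirc e i pone p) p;
  pcirc1r : forall n (e : (n + 1 = n.+1)%N) (i : 'I_n) (p : pre n),
    peq (pcirc e i p pone) p;
  pcirc_seq : forall m n l a b t
      (e1 : (m + n = a.+1)%N) (e2 : (a + l = t.+1)%N)
      (e3 : (n + l = b.+1)%N) (e4 : (m + b = t.+1)%N)
      (i : 'I_m) (j : 'I_n) (h : 'I_a) (p : pre m) (q : pre n) (r : pre l),
    h = (i + j)%N :> nat ->
    peq (pcirc e2 h (pcirc e1 i p q) r) (pcirc e4 i p (pcirc e3 j q r));
  pcirc_par : forall m n l a b t
      (e1 : (m + n = a.+1)%N) (e2 : (a + l = t.+1)%N)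
      (e3 : (m + l = b.+1)%N) (e4 : (b + n = t.+1)%N)
      (i j : 'I_m) (j' : 'I_a) (i' : 'I_b) (p : pre m) (q : pre n) (r : pre l),
    (i < j)%N -> j' = outer i n j :> nat -> i' = i :> nat ->
    peq (pcirc e2 j' (pcirc e1 i p q) r) (pcirc e4 i' (pcirc e3 j p r) q);
  pcirc_act : forall m n a (e : (m + n = a.+1)%N) (i : 'I_m)
      (s : 'S_m) (t : 'S_n) (r : 'S_a) (p : pre m) (q : pre n),
    block_perm i s t r ->
    peq (pcirc e (s i) (pact p s) (pact q t)) (pact (pcirc e i p q) r)
}.

Section ClassOperad.
Context (k : fieldType) (P : preoperad k).

Definition peqb n : rel {classic P n} := fun p q => `[< @peq k P n p q >].

Lemma peqb_equiv n : equiv_class_of (@peqb n).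
Proof.
split=> [p|p q|q p r].
- exact/asboolP/peq_refl.
- by apply/asboolP/asboolP; apply: peq_sym.
- by move=> /asboolP pq /asboolP qr; apply/asboolP; apply: peq_trans pq qr.
Qed.

Definition peq_equiv n : equiv_rel {classic P n} := EquivRelPack (peqb_equiv n).

Definition class n := {eq_quot peq_equiv n}.
HB.instance Definition _ n := Choice.on (class n).

Definition cls n (p : P n) : class n := \pi_(class n) (p : {classic P n}).
Definition rep n (x : class n) : P n := repr x.

Lemma clsK n (x : class n) : cls (rep x) = x.
Proof. exact: reprK. Qed.

Lemma cls_eq n (p q : P n) : cls p = cls q <-> peq p q.
Proof.
split=> [/eqP|pq]; first by rewrite eqmodE => /asboolP.
by apply/eqP; rewrite eqmodE; apply/asboolP.
Qed.

Lemma rep_cls n (p : P n) : peq (rep (cls p)) p.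
Proof. by apply/cls_eq; rewrite clsK. Qed.

Fact class_key : unit. Proof. exact: tt. Qed.

Definition cadd n (x y : class n) : class n :=
  locked_with class_key (cls (padd (rep x) (rep y))).
Definition cscale n a (x : class n) : class n :=
  locked_with class_key (cls (pscale a (rep x))).
Definition copp n (x : class n) : class n := cscale (-1) x.

Lemma caddE n (p q : P n) : cadd (cls p) (cls q) = cls (padd p q).
Proof. by rewrite /cadd unlock; apply/cls_eq/padd_eq; apply: rep_cls. Qed.
Lemma cscaleE n a (p : P n) : cscale a (cls p) = cls (pscale a p).
Proof. by rewrite /cscale unlock; apply/cls_eq/pscale_eq/rep_cls. Qed.

Fact caddA n : associative (@cadd n).
Proof.
move=> x y z; rewrite -(clsK x) -(clsK y) -(clsK z) !caddE.
exact/cls_eq/paddA.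
Qed.
Fact caddC n : commutative (@cadd n).
Proof. by move=> x y; rewrite -(clsK x) -(clsK y) !caddE; apply/cls_eq/paddC. Qed.
Fact cadd0 n : left_id (cls (pzero P n)) (@cadd n).
Proof. by move=> x; rewrite -(clsK x) caddE; apply/cls_eq/padd0. Qed.
Fact caddN n : left_inverse (cls (pzero P n)) (@copp n) (@cadd n).
Proof.
move=> x; rewrite -(clsK x) /copp cscaleE caddE.
exact/cls_eq/paddN.
Qed.
HB.instance Definition _ n :=
  GRing.isZmodule.Build (class n) (@caddA n) (@caddC n) (@cadd0 n) (@caddN n).

Lemma clsD n (p q : P n) : cls p + cls q = cls (padd p q).
Proof. exact: caddE. Qed.

Fact cscaleA n a b (x : class n) : cscale a (cscale b x) = cscale (a * b) x.
Proof. by rewrite -(clsK x) !cscaleE; apply/cls_eq/pscaleA. Qed.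
Fact cscale1 n : left_id 1 (@cscale n).
Proof. by move=> x; rewrite -(clsK x) !cscaleE; apply/cls_eq/pscale1. Qed.
Fact cscaleDr n : right_distributive (@cscale n) +%R.
Proof.
move=> a x y; rewrite -(clsK x) -(clsK y).
by rewrite clsD !cscaleE clsD; apply/cls_eq/pscaleDr.
Qed.
Fact cscaleDl n (x : class n) : {morph (@cscale n)^~ x : a b / a + b}.
Proof.
move=> a b; rewrite -(clsK x) !cscaleE clsD.
exact/cls_eq/pscaleDl.
Qed.
HB.instance Definition _ n :=
  GRing.Zmodule_isLmodule.Build k (class n)
    (@cscaleA n) (@cscale1 n) (@cscaleDr n) (@cscaleDl n).

Definition cact n (x : class n) (s : 'S_n) : class n :=
  locked_with class_key (cls (pact (rep x) s)).
Definition ccirc m n r (e : (m + n = r.+1)%N) i (x : class m) (y : class n) :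
    class r :=
  locked_with class_key (cls (pcirc e i (rep x) (rep y))).

Lemma clsZ n a (p : P n) : a *: cls p = cls (pscale a p).
Proof. exact: cscaleE. Qed.
Lemma cls0 n : 0 = cls (pzero P n). Proof. by []. Qed.
Lemma cactE n (p : P n) s : cact (cls p) s = cls (pact p s).
Proof. by rewrite /cact unlock; apply/cls_eq/pact_eq/rep_cls. Qed.
Lemma ccircE m n r (e : (m + n = r.+1)%N) i (p : P m) (q : P n) :
  ccirc e i (cls p) (cls q) = cls (pcirc e i p q).
Proof. by rewrite /ccirc unlock; apply/cls_eq/pcirc_eq; apply: rep_cls. Qed.

Let cE := (clsD, clsZ, cactE, ccircE).

Definition class_operad : operad k.
Proof.
refine (@Operad k (fun n => class n : lmodType k)
  cact (cls (pone P)) ccirc _ _ _ _ _ _ _ _ _ _).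
- move=> n s a x y; rewrite -(clsK x) -(clsK y) !cE.
  exact/cls_eq/pact_linear.
- move=> n x; rewrite -(clsK x) !cE; exact/cls_eq/pact1.
- move=> n x s t; rewrite -(clsK x) !cE; exact/cls_eq/pactM.
- move=> m n r e i y a x x'; rewrite -(clsK x) -(clsK x') -(clsK y) !cE.
  exact/cls_eq/pcirc_linearl.
- move=> m n r e i x a y y'; rewrite -(clsK x) -(clsK y) -(clsK y') !cE.
  exact/cls_eq/pcirc_linearr.
- move=> n e i x; rewrite -(clsK x) !cE; exact/cls_eq/pcirc1l.
- move=> n e i x; rewrite -(clsK x) !cE; exact/cls_eq/pcirc1r.
- move=> m n l a b t e1 e2 e3 e4 i j h x y z hE.
  rewrite -(clsK x) -(clsK y) -(clsK z) !cE; exact/cls_eq/pcirc_seq.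
- move=> m n l a b t e1 e2 e3 e4 i j j' i' x y z ij j'E i'E.
  rewrite -(clsK x) -(clsK y) -(clsK z) !cE.
  exact/cls_eq/(pcirc_par _ _ _ _ _ _ _ ij).
- move=> m n a e i s t r x y rE; rewrite -(clsK x) -(clsK y) !cE.
  exact/cls_eq/pcirc_act.
Defined.

End ClassOperad.

Record is_ideal (k : fieldType) (P : operad k) (I : forall n, P n -> Prop) :
    Prop := IsIdeal {
  ideal0 : forall n, I n 0;
  idealP : forall n a (p q : P n), I n p -> I n q -> I n (a *: p + q);
  ideal_act : forall n (p : P n) s, I n p -> I n (act p s);
  ideal_circl : forall m n r (e : (m + n = r.+1)%N) i (p : P m) (q : P n),
    I m p -> I r (circ e i p q);
  ideal_circr : forall m n r (e : (m + n = r.+1)%N) i (p : P m) (q : P n),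
    I n q -> I r (circ e i p q)
}.

(* The smallest ideal containing a set [X] of elements of arity [d]. *)
Definition ideal_gen (k : fieldType) (P : operad k) (d : nat) (X : P d -> Prop)
    (n : nat) (p : P n) : Prop :=
  forall I : (forall m, P m -> Prop),
    is_ideal I -> (forall q, X q -> I d q) -> I n p.

Lemma ideal_gen_ideal (k : fieldType) (P : operad k) d (X : P d -> Prop) :
  is_ideal (ideal_gen X).
Proof.
split.
- by move=> n I idI _; apply: ideal0.
- by move=> n a p q Ip Iq I idI XI; apply: idealP; [|apply: Ip|apply: Iq].
- by move=> n p s Ip I idI XI; apply: ideal_act; [|apply: Ip].
- by move=> m n r e i p q Ip I idI XI; apply: ideal_circl; [|apply: Ip].
- by move=> m n r e i p q Iq I idI XI; apply: ideal_circr; [|apply: Iq].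
Qed.

Section QuotientOperad.
Context (k : fieldType) (P : operad k) (I : forall n, P n -> Prop).
Context (idI : is_ideal I).

Let eqI n (p q : P n) : Prop := I (p - q).

Let eqI_refl n (p q : P n) : p = q -> eqI p q.
Proof. by move=> ->; rewrite /eqI subrr; apply: ideal0 idI _. Qed.
Let IZ n a (p : P n) : I p -> I (a *: p).
Proof. by move=> Ip; rewrite -[_ *: _]addr0; apply: idealP; rewrite //; apply: ideal0. Qed.
Let ID n (p q : P n) : I p -> I q -> I (p + q).
Proof. by move=> Ip Iq; rewrite -[p]scale1r; apply: idealP. Qed.

Definition quotient_pre : preoperad k.
Proof.
refine (@PreOperad k (fun n => P n) eqI (fun n => 0) (fun n => +%R)
  (fun n => *:%R) (@act k P) (one P) (@circ k P)
  _ _ _ _ _ _ _ _ _ _ _ _ _ _ _ _ _ _ _ _ _ _ _ _ _);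
  try by (intros; apply: eqI_refl;
    first [ exact: addrA | exact: addrC | exact: add0r | exact: scalerA
          | exact: scale1r | exact: scalerDr | exact: scalerDl
          | exact: act_linear | exact: act1 | exact: actM
          | exact: circ_linearl | exact: circ_linearr
          | exact: circ1l | exact: circ1r | exact: circ_seq
          | exact: circ_par | exact: circ_act
          | by [] | by rewrite scaleN1r addNr ]).
- by move=> n p q pq; rewrite /eqI -opprB -scaleN1r; apply: IZ.
- by move=> n p q r pq qr; rewrite /eqI -(subrKA q); apply: ID.
- by move=> n p p' q q' pp qq; rewrite /eqI opprD addrACA; apply: ID.
- by move=> n a p p' pp; rewrite /eqI -scalerBr; apply: IZ.
- move=> n p p' s pp; rewrite /eqI addrC -scaleN1r -act_linear.
  by apply: ideal_act; rewrite // scaleN1r addrC.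
- move=> m n r e i p p' q q' pp qq.
  rewrite /eqI -(subrKA (circ e i p' q)); apply: ID.
  + rewrite addrC -scaleN1r -circ_linearl; apply: ideal_circl => //.
    by rewrite scaleN1r addrC.
  + rewrite addrC -scaleN1r -circ_linearr; apply: ideal_circr => //.
    by rewrite scaleN1r addrC.
Defined.

Definition quotient_operad : operad k := class_operad quotient_pre.

End QuotientOperad.

(* A finite-dimensional space is given with a finite basis [I]. *)
Notation vec k I := {ffun I -> k^o}.

Section Vec.
Context (k : fieldType).
Implicit Types I J : finType.

Definition bvec I (i : I) : vec k I := [ffun j => (i == j)%:R].

Definition lext I J (f : I -> vec k J) (v : vec k I) : vec k J :=
  \sum_i v i *: f i.

Fact lext_linear I J (f : I -> vec k J) : linear (lext f).
Proof.
move=> a u v; rewrite /lext scaler_sumr -big_split; apply: eq_bigr => i _.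
by rewrite !ffunE scalerDl scalerA.
Qed.
HB.instance Definition _ I J (f : I -> vec k J) :=
  GRing.isLinear.Build k (vec k I) (vec k J) _ (lext f) (lext_linear f).

(* The tensor product of the spaces based on [I] and [J] is based on [I * J]. *)
Definition tens I J (u : vec k I) (v : vec k J) : vec k (I * J)%type :=
  [ffun p => u p.1 * v p.2].

Definition tensv I J (U : {vspace vec k I}) (V : {vspace vec k J}) :
    {vspace vec k (I * J)%type} :=
  <<[seq tens u v | u <- vbasis U, v <- vbasis V]>>%VS.

Lemma lext_bvec I J (f : I -> vec k J) i : lext f (bvec i) = f i.
Proof.
rewrite /lext (bigD1 i) //= big1 ?addr0 => [|j ji]; rewrite ffunE.
  by rewrite eqxx scale1r.
by rewrite eq_sym (negPf ji) scale0r.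
Qed.

Lemma vec_sum I (v : vec k I) : v = \sum_i v i *: bvec i.
Proof.
apply/ffunP=> j; rewrite sum_ffunE (bigD1 j) //= big1 => [|i ij].
  by rewrite !ffunE eqxx addr0 [_ *: _]mulr1.
by rewrite !ffunE (negPf ij) scaler0.
Qed.

Lemma lin_ext I (W : lmodType k) (f g : vec k I -> W) :
  linear f -> linear g -> (forall i, f (bvec i) = g (bvec i)) -> f =1 g.
Proof.
move=> fl gl fg v.
pose F := GRing.isLinear.Build k _ _ _ f fl.
pose f' : {linear vec k I -> W} := HB.pack f F.
pose G := GRing.isLinear.Build k _ _ _ g gl.
pose g' : {linear vec k I -> W} := HB.pack g G.
change (f' v = g' v); rewrite [v]vec_sum !linear_sum.
by apply: eq_bigr => i _; rewrite !linearZ /=; congr (_ *: _); apply: fg.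
Qed.

Lemma tens_linearl I J (v : vec k J) : linear (fun u : vec k I => tens u v).
Proof.
move=> a u u'; apply/ffunP=> p; rewrite !ffunE mulrDl; congr (_ + _).
by symmetry; apply: mulrA.
Qed.

Lemma tens_linearr I J (u : vec k I) : linear (fun v : vec k J => tens u v).
Proof.
move=> a v v'; apply/ffunP=> p; rewrite !ffunE mulrDr; congr (_ + _).
exact: mulrCA.
Qed.

Lemma tens_bvec I J (i : I) (j : J) : tens (bvec i) (bvec j) = bvec (i, j).
Proof. by apply/ffunP=> -[a b]; rewrite !ffunE xpair_eqE /= -natrM mulnb. Qed.

Lemma lext_tens I I' J J' (f : I -> vec k I') (g : J -> vec k J') u v :
  lext (fun p => tens (f p.1) (g p.2)) (tens u v) = tens (lext f u) (lext g v).
Proof.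
move: u; apply: lin_ext => [a x y|a x y|i]; rewrite ?tens_linearl ?linearP //=.
  by rewrite tens_linearl.
move: v; apply: lin_ext => [a x y|a x y|j]; rewrite ?tens_linearr ?linearP //=.
  by rewrite tens_linearr.
by rewrite tens_bvec !lext_bvec.
Qed.

Lemma mem_tensv I J (U : {vspace vec k I}) (V : {vspace vec k J}) u v :
  u \in U -> v \in V -> tens u v \in tensv U V.
Proof.
move=> /coord_vbasis-> /coord_vbasis->.
pose F w := GRing.isLinear.Build k _ _ _ _ (@tens_linearl I J w).
pose L w : {linear vec k I -> vec k (I * J)%type} :=
  HB.pack (fun x => tens x w) (F w).
pose G w := GRing.isLinear.Build k _ _ _ _ (@tens_linearr I J w).
pose M w : {linear vec k J -> vec k (I * J)%type} := HB.pack (tens w) (G w).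
rewrite -[tens _ _]/(L _ _) linear_sum; apply: rpred_sum => i _.
rewrite linearZ; apply: rpredZ => /=.
rewrite -[tens _ _]/(M _ _) linear_sum; apply: rpred_sum => j _.
rewrite linearZ; apply: rpredZ => /=.
by apply: memv_span; apply: allpairs_f; apply: mem_nth; rewrite size_tuple.
Qed.

Lemma tensv_sub I J (U : {vspace vec k I}) (V : {vspace vec k J})
    (X : {vspace vec k (I * J)%type}) :
  (forall u v, u \in U -> v \in V -> tens u v \in X) -> (tensv U V <= X)%VS.
Proof.
move=> UVX; apply/span_subvP=> _ /allpairsP[[u v] [/= uU vV ->]].
by apply: UVX; apply: vbasis_mem.
Qed.

End Vec.

Record s2module (k : fieldType) := S2Module {
  basis :> finType;
  flip_basis : basis -> vec k basis;
  flip_basisK : forall i, lext flip_basis (flip_basis i) = bvec k i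
}.

(* The action of the transposition: [(flip m)(x, y) = m(y, x)]. *)
Definition flip (k : fieldType) (V : s2module k) : vec k V -> vec k V :=
  lext (@flip_basis k V).
HB.instance Definition _ (k : fieldType) (V : s2module k) :=
  GRing.Linear.on (@flip k V).

Section S2Modules.
Context (k : fieldType).

Lemma flipK (V : s2module k) : involutive (@flip k V).
Proof.
apply: lin_ext => [a u v|a u v|i]; rewrite ?linearP //.
by rewrite /flip lext_bvec flip_basisK.
Qed.

Fact trivial_flipK (i : unit) :
  lext (fun=> bvec k tt) (bvec k tt) = bvec k i.
Proof. by case: i; rewrite lext_bvec. Qed.
Definition trivial_module := S2Module trivial_flipK.

Fact sgn_flipK (i : unit) :
  lext (fun=> - bvec k tt) (- bvec k tt) = bvec k i.
Proof. by case: i; rewrite linearN /= lext_bvec opprK. Qed.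
Definition sgn_module := S2Module sgn_flipK.

(* The free k[S_2]-module of rank [g]. *)
Definition free_flip (g : nat) (i : 'I_g * bool) : vec k ('I_g * bool)%type :=
  bvec k (i.1, ~~ i.2).
Fact free_flipK g (i : 'I_g * bool) :
  lext (@free_flip g) (free_flip i) = bvec k i.
Proof.
by case: i => i b; rewrite {2}/free_flip lext_bvec /free_flip negbK.
Qed.
Definition free_module (g : nat) := S2Module (@free_flipK g).

Definition tens_flip (V W : s2module k) (p : V * W) : vec k (V * W)%type :=
  tens (flip_basis p.1) (flip_basis p.2).
Fact tens_flipK (V W : s2module k) (p : V * W) :
  lext (@tens_flip V W) (tens_flip p) = bvec k p.
Proof.
by case: p => i j; rewrite lext_tens !flip_basisK tens_bvec.
Qed.
Definition tens_module (V W : s2module k) := S2Module (@tens_flipK V W).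

Lemma flip_tens (V W : s2module k) (u : vec k V) (v : vec k W) :
  @flip k (tens_module V W) (tens u v) = tens (flip u) (flip v).
Proof. exact: lext_tens. Qed.

End S2Modules.

Section FreeOperad.
Context (k : fieldType) (V : s2module k).

Inductive term : nat -> Type :=
| Gen of vec k V : term 2%N
| One : term 1%N
| Zero n : term n
| Add n of term n & term n : term n
| Scale n of k & term n : term n
| Act n of term n & 'S_n : term n
| Circ m n r of (m + n = r.+1)%N & 'I_m & term m & term n : term r.

Fixpoint eval (P : operad k) (f : vec k V -> P 2%N) n (t : term n) : P n :=
  match t in term n return P n with
  | Gen v => f v
  | One => one P
  | Zero n => 0
  | Add n t u => eval f t + eval f u
  | Scale n a t => a *: eval f t
  | Act n t s => act (eval f t) s
  | Circ m n r e i t u => circ e i (eval f t) (eval f u)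
  end.

Definition s2linear (P : operad k) (f : vec k V -> P 2%N) : Prop :=
  linear f /\ forall v, f (flip v) = act (f v) (tperm 0 1).

(* Formal operadic expressions in the elements of [V] are identified when they
   have the same value in every operad; see [free_operadP] for the universal
   property. *)
Definition teq n (t u : term n) : Prop :=
  forall (P : operad k) (f : vec k V -> P 2%N), s2linear f -> eval f t = eval f u.

Definition free_pre : preoperad k.
Proof.
refine (@PreOperad k term teq Zero Add Scale Act One Circ
  _ _ _ _ _ _ _ _ _ _ _ _ _ _ _ _ _ _ _ _ _ _ _ _ _).
- by move=> n p P f fV.
- by move=> n p q pq P f fV; rewrite pq.
- by move=> n p q r pq qr P f fV; rewrite pq ?qr.
- by move=> n p p' q q' pp qq P f fV /=; rewrite pp ?qq.
- by move=> n a p p' pp P f fV /=; rewrite pp.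
- by move=> n p p' s pp P f fV /=; rewrite pp.
- by move=> m n r e i p p' q q' pp qq P f fV /=; rewrite pp ?qq.
- by move=> n p q r P f fV; apply: addrA.
- by move=> n p q P f fV; apply: addrC.
- by move=> n p P f fV; apply: add0r.
- by move=> n p P f fV /=; rewrite scaleN1r addNr.
- by move=> n a b p P f fV; apply: scalerA.
- by move=> n p P f fV; apply: scale1r.
- by move=> n a p q P f fV; apply: scalerDr.
- by move=> n p a b P f fV; apply: scalerDl.
- by move=> n s a p q P f fV; apply: act_linear.
- by move=> n p P f fV; apply: act1.
- by move=> n p s t P f fV; apply: actM.
- by move=> m n r e i q a p p' P f fV; apply: circ_linearl.
- by move=> m n r e i p a q q' P f fV; apply: circ_linearr.
- by move=> n e i p P f fV; apply: circ1l.
- by move=> n e i p P f fV; apply: circ1r.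
- by move=> *; move=> P f fV; apply: circ_seq.
- by move=> m n l a b t e1 e2 e3 e4 i j j' i' p q r ij jE iE P f fV;
    apply: (circ_par _ _ _ _ _ _ _ ij).
- by move=> *; move=> P f fV; apply: circ_act.
Defined.

Definition free_operad : operad k := class_operad free_pre.

Definition gen (v : vec k V) : free_operad 2%N := cls (Gen v : free_pre 2%N).

Lemma gen_s2linear : s2linear gen.
Proof.
split=> [a u v|v].
  rewrite /gen.
  transitivity (cls (padd (pscale a (Gen u : free_pre 2%N)) (Gen v : free_pre 2%N))).
    by apply/cls_eq => P f [fl _]; apply: fl.
  by rewrite -clsD -clsZ.
by rewrite /gen [act _ _]cactE; apply/cls_eq => P f [_ fV] /=; apply: fV.
Qed.

Lemma free_operadP (P : operad k) (f : vec k V -> P 2%N) : s2linear f ->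
  exists g : forall n, free_operad n -> P n,
    [/\ operad_morphism g, forall v, g 2%N (gen v) = f v &
        forall h : (forall n, free_operad n -> P n), operad_morphism h ->
          (forall v, h 2%N (gen v) = f v) -> forall n, h n =1 g n].
Proof.
move=> fV; pose g n (x : free_operad n) := eval f (rep x : term n).
have gE n (t : term n) : g n (cls (t : free_pre n)) = eval f t.
  by have /(_ P f fV) := rep_cls (t : free_pre n).
exists g; split=> [|v|h [hl ha h1 hc] hV n x]; first last.
- pose hl' m := GRing.isLinear.Build k _ _ _ _ (hl m).
  pose h' m : {linear free_operad m -> P m} := HB.pack (h m) (hl' m).
  rewrite -(clsK x) gE; elim: (rep x : term n) => {n x}
    [v||n|n t IHt u IHu|n a t IHt|n t IHt s|m n r e i t IHt u IHu] /=.
  + exact: hV.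
  + exact: h1.
  + exact: (linear0 (h' n)).
  + rewrite -IHt -IHu -[RHS](linearD (h' n)) /=; congr (h n _).
    by rewrite [RHS]clsD.
  + rewrite -IHt -[RHS](linearZZ (h' n)) /=; congr (h n _).
    by rewrite [RHS]clsZ.
  + by rewrite -IHt -ha; congr (h n _); rewrite [RHS]cactE.
  + by rewrite -IHt -IHu -hc; congr (h r _); rewrite [RHS]ccircE.
- exact: gE.
- split=> [n a x y|n x s||m n r e i x y].
  + transitivity (g n (cls (Add (Scale a (rep x)) (rep y) : free_pre n)));
      last exact: gE.
    congr (g n _); rewrite -{1}(clsK x) -{1}(clsK y).
    exact: etrans (congr1 (+%R^~ _) (clsZ _ _)) (clsD _ _).
  + transitivity (g n (cls (Act (rep x) s : free_pre n))); last exact: gE.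
    by congr (g n _); rewrite -{1}(clsK x); apply: cactE.
  + exact: gE.
  + transitivity (g r (cls (Circ e i (rep x) (rep y) : free_pre r)));
      last exact: gE.
    by congr (g r _); rewrite -{1}(clsK x) -{1}(clsK y); apply: ccircE.
Qed.

End FreeOperad.

(* F(V)(3) is three copies of V (x) V, i.e. it is based on ['I_3 * V * V].  The
   copies are indexed by the variable that is not under the inner operation:
     [tree c m n] = m(n(x_(c+1), x_(c+2)), x_c)   (indices modulo 3),
   so that, for (x_0, x_1, x_2) = (x, y, z),
     m o_I n = [tree 2 m n], m o_II n = [tree 0 m n], m o_III n = [tree 1 m n]. *)
Notation vec3 k V := (vec k ('I_3 * (basis V) * (basis V))%type).

Section Arity3.
Context (k : fieldType).
Implicit Types V W : s2module k.

Definition tree V (c : 'I_3) (m n : vec k V) : vec3 k V :=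
  tens (tens (bvec k c) m) n.

Definition flipn V (b : bool) (v : vec k V) : vec k V :=
  if b then flip v else v.

(* Renaming the variables of [tree c m n] along [s] gives
   m(n(x_(s (c+1)), x_(s (c+2))), x_(s c)), and (s (c+1), s (c+2)) is
   (s c + 1, s c + 2) if [s] is even and (s c + 2, s c + 1) if [s] is odd. *)
Definition act3 V (s : 'S_3) : vec3 k V -> vec3 k V :=
  lext (fun t => tree (s t.1.1) (bvec k t.1.2) (flipn (odd_perm s) (bvec k t.2))).
HB.instance Definition _ V s := GRing.Linear.on (@act3 V s).

Definition rotation (c : 'I_3) : 'S_3 := perm (@addIr _ (c + 1)).

(* The element of the free operad represented by an element of [vec3 k V]. *)
Definition tree3 V (x : vec3 k V) : free_operad V 3%N :=
  \sum_t x t *: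
    act (circ (erefl : 2 + 2 = 4)%N ord0 (gen (bvec k t.1.2)) (gen (bvec k t.2)))
        (rotation t.1.1).

Lemma treeb V c (i j : V) : tree c (bvec k i) (bvec k j) = bvec k (c, i, j).
Proof. by rewrite /tree !tens_bvec. Qed.

Lemma tree_linearl V c (n : vec k V) : linear (fun m => tree c m n).
Proof. by move=> a u v; rewrite /tree tens_linearr tens_linearl. Qed.
Lemma tree_linearr V c (m : vec k V) : linear (tree c m).
Proof. by move=> a u v; rewrite /tree tens_linearr. Qed.

Fact flipn_linear V b : linear (@flipn V b).
Proof. by move=> a u v; rewrite /flipn; case: b; rewrite ?linearP. Qed.
HB.instance Definition _ V b :=
  GRing.isLinear.Build k _ _ _ (@flipn V b) (@flipn_linear V b).

Lemma flipnM V a b (v : vec k V) : flipn a (flipn b v) = flipn (a (+) b) v.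
Proof. by case: a; case: b; rewrite /flipn ?flipK. Qed.

Lemma flipn_tens V W b (u : vec k V) (v : vec k W) :
  @flipn (tens_module V W) b (tens u v) = tens (flipn b u) (flipn b v).
Proof. by case: b; rewrite /flipn ?flip_tens. Qed.

Lemma flipn_sgn b v : @flipn (sgn_module k) b v = (-1) ^+ b *: v.
Proof.
case: b; rewrite /flipn ?scale1r // expr1.
move: v; apply: lin_ext => [a u v|a u v|[]]; rewrite ?linearP //.
by rewrite /flip lext_bvec scaleN1r.
Qed.

Lemma act3_tree V s c (m n : vec k V) :
  act3 s (tree c m n) = tree (s c) m (flipn (odd_perm s) n).
Proof.
move: m; apply: lin_ext => [a x y|a x y|i]; rewrite ?tree_linearl ?linearP //.
move: n; apply: lin_ext => [a x y|a x y|j]; rewrite ?tree_linearr ?linearP //=.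
  by rewrite tree_linearr.
by rewrite treeb /act3 lext_bvec.
Qed.

Lemma act3M V s t (x : vec3 k V) : act3 t (act3 s x) = act3 (s * t)%g x.
Proof.
move: x; apply: lin_ext => [a x y|a x y|[[c i] j]]; rewrite ?linearP //.
by rewrite -treeb !act3_tree permM odd_permM flipnM addbC.
Qed.

Lemma tree3_linear V : linear (@tree3 V).
Proof.
move=> a x y; rewrite /tree3 scaler_sumr -big_split; apply: eq_bigr => t _.
by rewrite !ffunE scalerDl scalerA.
Qed.

Lemma tree3_tree V c (m n : vec k V) :
  tree3 (tree c m n) =
  act (circ (erefl : 2 + 2 = 4)%N ord0 (gen m) (gen n)) (rotation c).
Proof.
have [gl _] := gen_s2linear V.
move: m; apply: lin_ext => [a x y|a x y|i].
- by rewrite tree_linearl tree3_linear.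
- by rewrite gl circ_linearl act_linear.
move: n; apply: lin_ext => [a x y|a x y|j].
- by rewrite tree_linearr tree3_linear.
- by rewrite gl circ_linearr act_linear.
rewrite treeb /tree3 (bigD1 (c, i, j)) //= big1 ?addr0 => [|t tij].
  by rewrite ffunE eqxx scale1r.
by rewrite ffunE eq_sym (negPf tij) scale0r.
Qed.

Lemma tree3_act V (s : 'S_3) (x : vec3 k V) :
  tree3 (act3 s x) = act (tree3 x) s.
Proof.
have [ts -> dts] := prod_tpermP s; elim: ts dts x => [_|[a b] ts IH] /=.
  move=> x; rewrite big_nil act1; congr tree3.
  move: x; apply: lin_ext => [a x y|a x y|[[c i] j]]; rewrite ?linearP //.
  by rewrite -treeb act3_tree perm1 odd_perm1.
case/andP=> ab dts x; rewrite big_cons -act3M actM IH //.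
suff -> : tree3 (act3 (tperm a b) x) = act (tree3 x) (tperm a b) by [].
move: x; apply: lin_ext => [e x y|e x y|[[c i] j]].
- by rewrite linearP tree3_linear.
- by rewrite tree3_linear act_linear.
rewrite -treeb act3_tree odd_tperm ab /flipn !tree3_tree.
have [_ ->] := gen_s2linear V.
have rE : block_perm (ord0 : 'I_2) 1%g (tperm 0 1 : 'S_2) (tperm 0 1 : 'S_3).
  by split; move=> [[|[|l]] ?] [[|[|[|h]]] ?] //=; rewrite !permE.
rewrite -[gen (bvec k i)]act1 -{1}[ord0](perm1 ord0) (circ_act _ _ _ rE) act1.
rewrite -!actM; apply: (congr1 (act _)); apply/permP=> l; apply/val_inj.
rewrite !permM !permE /= => {dts IH i j rE}.
by move: a b c l ab; do 4 case=> [[|[|[|//]]] ?].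
Qed.

End Arity3.

Record quadratic_data (k : fieldType) := QuadraticData {
  gens : s2module k;
  rels : {vspace vec3 k gens};
  rels_stable : forall (s : 'S_3) x, x \in rels -> act3 s x \in rels
}.

Definition quadratic_operad (k : fieldType) (P : quadratic_data k) : operad k :=
  quotient_operad (ideal_gen_ideal
    (fun p : free_operad (gens P) 3%N => exists2 x, x \in rels P & p = tree3 x)).

Section Products.
Context (k : fieldType).
Implicit Types V W : s2module k.

(* [Phi] and [Psi] are defined on bases; [Phi_tree] and [Psi_tree] are the
   formulas for arbitrary vectors. *)
Definition Phi V W : vec3 k (tens_module V W) ->
    vec k (('I_3 * V * V) * ('I_3 * W * W))%type :=
  lext (fun t : 'I_3 * (V * W) * (V * W) =>
    let: (c, (i, i'), (j, j')) := t in
    tens (tree c (bvec k i) (bvec k j)) (tree c (bvec k i') (bvec k j'))).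
HB.instance Definition _ V W := GRing.Linear.on (@Phi V W).

Definition Psi V W : vec k (('I_3 * V * V) * ('I_3 * W * W))%type ->
    vec3 k (tens_module (tens_module V W) (sgn_module k)) :=
  lext (fun t : ('I_3 * V * V) * ('I_3 * W * W) =>
    let: ((c, i, j), (d, i', j')) := t in
    (c == d)%:R *: @tree k (tens_module (tens_module V W) (sgn_module k)) c
      (tens (tens (bvec k i) (bvec k i')) (bvec k tt))
      (tens (tens (bvec k j) (bvec k j')) (bvec k tt))).
HB.instance Definition _ V W := GRing.Linear.on (@Psi V W).

Lemma Phi_tree V W c (m n : vec k V) (m' n' : vec k W) :
  Phi (@tree k (tens_module V W) c (tens m m') (tens n n')) =
  tens (tree c m n) (tree c m' n').
Proof.
move: m; apply: lin_ext => [a x y|a x y|i].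
- by rewrite tens_linearl tree_linearl linearP.
- by rewrite tree_linearl tens_linearl.
move: n; apply: lin_ext => [a x y|a x y|j].
- by rewrite tens_linearl tree_linearr linearP.
- by rewrite tree_linearr tens_linearl.
move: m'; apply: lin_ext => [a x y|a x y|i'].
- by rewrite tens_linearr tree_linearl linearP.
- by rewrite tree_linearl tens_linearr.
move: n'; apply: lin_ext => [a x y|a x y|j'].
- by rewrite tens_linearr tree_linearr linearP.
- by rewrite tree_linearr tens_linearr.
by rewrite !tens_bvec (@treeb k (tens_module V W)) /Phi lext_bvec.
Qed.

Lemma Psi_tree V W c d (m n : vec k V) (m' n' : vec k W) :
  Psi (tens (tree c m n) (tree d m' n')) =
  (c == d)%:R *: @tree k (tens_module (tens_module V W) (sgn_module k)) c
    (tens (tens m m') (bvec k tt)) (tens (tens n n') (bvec k tt)).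
Proof.
have sZ (U : lmodType k) (e a : k) (x y : U) :
    e *: (a *: x + y) = a *: (e *: x) + e *: y.
  by rewrite scalerDr !scalerA mulrC.
move: m; apply: lin_ext => [a x y|a x y|i].
- by rewrite tree_linearl tens_linearl linearP.
- by rewrite !tens_linearl tree_linearl sZ.
move: n; apply: lin_ext => [a x y|a x y|j].
- by rewrite tree_linearr tens_linearl linearP.
- by rewrite !tens_linearl tree_linearr sZ.
move: m'; apply: lin_ext => [a x y|a x y|i'].
- by rewrite tree_linearl tens_linearr linearP.
- by rewrite tens_linearr tens_linearl tree_linearl sZ.
move: n'; apply: lin_ext => [a x y|a x y|j'].
- by rewrite tree_linearr tens_linearr linearP.
- by rewrite tens_linearr tens_linearl tree_linearr sZ.
by rewrite !treeb tens_bvec /Psi lext_bvec.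
Qed.

Definition act33 V W (s : 'S_3) : vec k (('I_3 * V * V) * ('I_3 * W * W))%type ->
    vec k (('I_3 * V * V) * ('I_3 * W * W))%type :=
  lext (fun p => tens (act3 s (bvec k p.1)) (act3 s (bvec k p.2))).
HB.instance Definition _ V W s := GRing.Linear.on (@act33 V W s).

Lemma act33_tens V W s (x : vec3 k V) (y : vec3 k W) :
  act33 s (tens x y) = tens (act3 s x) (act3 s y).
Proof.
move: x; apply: lin_ext => [a u v|a u v|i].
- by rewrite tens_linearl linearP.
- by rewrite linearP tens_linearl.
move: y; apply: lin_ext => [a u v|a u v|j].
- by rewrite tens_linearr linearP.
- by rewrite linearP tens_linearr.
by rewrite tens_bvec /act33 lext_bvec.
Qed.

Lemma Phi_act V W s (x : vec3 k (tens_module V W)) :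
  Phi (act3 s x) = act33 s (Phi x).
Proof.
move: x; apply: lin_ext => [a u v|a u v|[[c [i i']] [j j']]].
- by rewrite !linearP.
- by rewrite !linearP.
rewrite -treeb -!tens_bvec act3_tree flipn_tens !Phi_tree.
by rewrite act33_tens !act3_tree.
Qed.

Lemma Psi_act V W s (y : vec k (('I_3 * V * V) * ('I_3 * W * W))%type) :
  act3 s (Psi y) = (-1) ^+ odd_perm s *: Psi (act33 s y).
Proof.
move: y; apply: lin_ext => [a u v|a u v|[[[c i] j] [[d i'] j']]].
- by rewrite !linearP.
- by rewrite !linearP /= !scalerA mulrC.
rewrite -tens_bvec -!treeb act33_tens !act3_tree !Psi_tree linearZ /=.
rewrite act3_tree !flipn_tens flipn_sgn (inj_eq perm_inj).
set e := (-1) ^+ _; rewrite scalerA mulrC -scalerA; congr (_ *: _).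
have tZ (I J : finType) (u : vec k I) a (v : vec k J) :
    tens u (a *: v) = a *: tens u v.
  by apply/ffunP=> p; rewrite !ffunE; apply: mulrCA.
by rewrite /tree !tZ.
Qed.

Definition white_rels (P Q : quadratic_data k) :
    {vspace vec3 k (tens_module (gens P) (gens Q))} :=
  (linfun (@Phi (gens P) (gens Q)) @^-1:
    (tensv (rels P) fullv + tensv fullv (rels Q)))%VS.

Fact white_stable P Q s x : x \in white_rels P Q -> act3 s x \in white_rels P Q.
Proof.
rewrite /white_rels -!memv_preim !lfunE /= Phi_act.
move: (Phi x) => y; rewrite -[act33 s y](lfunE (@act33 _ _ s)) memv_preim.
apply: subvP; rewrite subv_add; apply/andP; split; apply: tensv_sub => u v uR vR;
  rewrite -memv_preim lfunE /= act33_tens.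
- by apply: (subvP (addvSl _ _)); apply: mem_tensv; rewrite ?memvf ?rels_stable.
- by apply: (subvP (addvSr _ _)); apply: mem_tensv; rewrite ?memvf ?rels_stable.
Qed.

Definition white (P Q : quadratic_data k) : quadratic_data k :=
  QuadraticData (@white_stable P Q).

Definition black_rels (P Q : quadratic_data k) :
    {vspace vec3 k (tens_module (tens_module (gens P) (gens Q)) (sgn_module k))} :=
  (linfun (@Psi (gens P) (gens Q)) @: tensv (rels P) (rels Q))%VS.

Fact black_stable P Q s x : x \in black_rels P Q -> act3 s x \in black_rels P Q.
Proof.
case/memv_imgP=> y yRS ->; rewrite lfunE /= Psi_act; apply: rpredZ.
rewrite -[Psi _](lfunE (@Psi _ _)); apply: memv_img.
rewrite -[act33 s y](lfunE (@act33 _ _ s)) memv_preim.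
move: y yRS; apply/subvP; apply: tensv_sub => u v uR vR.
by rewrite -memv_preim lfunE /= act33_tens mem_tensv ?rels_stable.
Qed.

Definition black (P Q : quadratic_data k) : quadratic_data k :=
  QuadraticData (@black_stable P Q).

Definition span3 V (rs : seq (vec3 k V)) : {vspace vec3 k V} :=
  <<[seq act3 s r | s <- enum 'S_3, r <- rs]>>%VS.

Fact span3_stable V (rs : seq (vec3 k V)) (s : 'S_3) x :
  x \in span3 rs -> act3 s x \in span3 rs.
Proof.
rewrite -[act3 s x](lfunE (@act3 k V s)) memv_preim; move: x; apply/subvP.
apply/span_subvP=> _ /allpairsP[[t r] [/= _ rrs ->]].
rewrite -memv_preim lfunE /= act3M; apply: memv_span.
by apply: allpairs_f; rewrite // mem_enum inE.
Qed.

Definition presented V (rs : seq (vec3 k V)) : quadratic_data k :=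
  QuadraticData (@span3_stable V rs).

(* For a permutation [s] of the variables x = x_0, y = x_1, z = x_2:
     [lcomb m n s] = m(n(x_(s 0), x_(s 1)), x_(s 2)),
     [rcomb m n s] = m(x_(s 0), n(x_(s 1), x_(s 2))). *)
Definition lcomb V (m n : vec k V) (s : 'S_3) : vec3 k V :=
  act3 s (tree 2%:R m n).
Definition rcomb V (m n : vec k V) (s : 'S_3) : vec3 k V :=
  act3 s (tree 0 (flip m) n).

Definition xyz : 'S_3 := 1%g.
Definition xzy : 'S_3 := tperm 1 2%:R.

(* The [i]-th generating operation of the free module of rank [g]. *)
Definition oper (g : nat) (i : 'I_g) : vec k (free_module k g) :=
  bvec k (i, false).

Definition As_data : quadratic_data k :=
  let m := @oper 1%N 0 in
  presented [:: lcomb m m xyz - rcomb m m xyz].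

Definition Com_data : quadratic_data k :=
  let m : vec k (trivial_module k) := bvec k tt in
  presented [:: lcomb m m xyz - rcomb m m xyz].

Definition Lie_data : quadratic_data k :=
  let b : vec k (sgn_module k) := bvec k tt in
  presented [:: tree 2%:R b b + tree 0 b b + tree 1 b b].

Definition PreLie_data : quadratic_data k :=
  let m := @oper 1%N 0 in
  presented [:: (lcomb m m xyz - rcomb m m xyz) - (lcomb m m xzy - rcomb m m xzy)].

Definition Perm_data : quadratic_data k :=
  let m := @oper 1%N 0 in
  presented [:: lcomb m m xyz - rcomb m m xyz; rcomb m m xyz - rcomb m m xzy].

Definition Zinb_data : quadratic_data k :=
  let m := @oper 1%N 0 in
  presented [:: lcomb m m xyz - (rcomb m m xyz + rcomb m m xzy)].

Definition Dend_data : quadratic_data k :=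
  let l := @oper 2%N 0 in
  let r := @oper 2%N 1 in
  presented
    [:: lcomb l l xyz - (rcomb l l xyz + rcomb l r xyz);
        lcomb l r xyz - rcomb r l xyz;
        (lcomb r l xyz + lcomb r r xyz) - rcomb r r xyz].

Definition Leib_data : quadratic_data k :=
  let b := @oper 1%N 0 in
  presented [:: rcomb b b xyz - (lcomb b b xyz - lcomb b b xzy)].

End Products.

(* Main.v *)
From HB Require Import structures.
Require Import Defs.
From mathcomp Require Import all_boot all_fingroup all_algebra ring.

Set Implicit Arguments.
Unset Strict Implicit.
Unset Printing Implicit Defensive.

Import GRing.Theory.
Local Open Scope ring_scope.

(** Each of the three products is a binary quadratic operad, and so is each of
    the operads it is identified with.  A linear isomorphism of S_2-modules of
    generators which carries one space of quadratic relations onto the other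
    induces an isomorphism of the free operads that exchanges the ideals of
    relations, hence an isomorphism of the operads (quadratic_operad_iso).
    Everything then takes place in arity 3, where the relations form a
    subspace of F(V)(3), spanned by the S_3-orbits of a few relators.

    Black products.  Let r be the pre-Lie relator
      (x0 x1) x2 - x0 (x1 x2) - (x0 x2) x1 + x0 (x2 x1)
    and let a be the associativity relator.  The map Psi is equivariant up to
    the signature, so Psi(R (x) S) is spanned, as an S_3-module, by the elements
    Psi(r (x) a.t), for t in S_3.  In r the variable x0 comes first in each
    monomial, so the shape of Psi(r (x) a.t) depends on the place that x0 has in
    the monomials of a.t: the first, second or third place gives the first, second
    or third dendriform relation, where, if m and u are the pre-Lie and the
    associative products,
      x < y is (m (x) u)(x, y)   and   x > y is (m (x) u.(12))(y, x),
    up to the signs due to the signature in the definition of the black product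
    (Psi_prelie_as).  For the commutative operad, u = u.(12), so y > x and x < y
    are the same operation, and the orbit of the relator of Com spans a
    plane that is generated by two of its elements; these two give the Zinbiel
    relation and its image under the exchange of the last two variables
    (Psi_prelie_com).

    White product.  Let [x, y] be m (x) b for the product m of Perm and the
    bracket b of Lie.  In Perm all the monomials with a given first variable
    are equal, so modulo the relations of Perm the Leibniz relator becomes such
    a monomial tensored with the Jacobi relator (leib_white).  Conversely, the
    Leibniz relation rewrites every monomial into left-normed ones
    [[x, y], z].  The coefficients of this normal form can be read off from the
    image under Phi: first variables are a well defined invariant for Perm, and
    differences of two coefficients are well defined modulo the Jacobi relator.
    So the normal form of an element of the white relations vanishes, and such
    an element is a consequence of the Leibniz relation (sub_normal_form). *)

(** * Isomorphisms between quotients of operads *)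

Section OperadMorphisms.
Context (k : fieldType).
Implicit Types P Q O : operad k.

Lemma morphism_comp P Q O
    (f : forall n, P n -> Q n) (g : forall n, Q n -> O n) :
  operad_morphism f -> operad_morphism g ->
  operad_morphism (fun n x => g n (f n x)).
Proof.
move=> [fl fa f1 fc] [gl ga g1 gc]; split.
- by move=> n a x y; rewrite fl gl.
- by move=> n p s; rewrite fa ga.
- by rewrite f1 g1.
- by move=> m n r e i p q; rewrite fc gc.
Qed.

Lemma morphism_id P : operad_morphism (fun n (x : P n) => x).
Proof. by split. Qed.

Lemma preimage_ideal P Q
    (f : forall n, P n -> Q n) (J : forall n, Q n -> Prop) :
  operad_morphism f -> is_ideal J -> is_ideal (fun n p => J n (f n p)).
Proof.
move=> [fl fa f1 fc] idJ; split.
- move=> n; have -> : f n 0 = 0; last exact: ideal0.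
  by have := fl n (-1) 0 0; rewrite !scaleN1r !addNr.
- by move=> n a p q Jp Jq; rewrite fl; apply: idealP.
- by move=> n p s Jp; rewrite fa; apply: ideal_act.
- by move=> m n r e i p q Jp; rewrite fc; apply: ideal_circl.
- by move=> m n r e i p q Jq; rewrite fc; apply: ideal_circr.
Qed.

Lemma quotient_morphism P Q
    (I : forall n, P n -> Prop) (J : forall n, Q n -> Prop)
    (idI : is_ideal I) (idJ : is_ideal J) (f : forall n, P n -> Q n) :
  operad_morphism f -> (forall n p, I n p -> J n (f n p)) ->
  exists2 h : forall n, quotient_operad idI n -> quotient_operad idJ n,
    operad_morphism h &
    forall n (p : P n), h n (cls (p : quotient_pre idI n)) =
                        cls (f n p : quotient_pre idJ n).
Proof.
move=> fM fIJ; have [fl fa f1 fc] := fM.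
pose h n (x : quotient_operad idI n) : quotient_operad idJ n :=
  cls (f n (rep x) : quotient_pre idJ n).
have hE n (p : P n) : h n (cls (p : quotient_pre idI n)) =
                      cls (f n p : quotient_pre idJ n).
  apply/cls_eq; rewrite /=.
  have /fIJ := rep_cls (p : quotient_pre idI n).
  by rewrite addrC -scaleN1r fl scaleN1r addrC.
exists h => //; split.
- move=> n a x y; rewrite -(clsK x) -(clsK y).
  by rewrite clsZ clsD !hE clsZ clsD /= fl.
- move=> n x s; rewrite -(clsK x) [X in h n X]cactE !hE [RHS]cactE.
  by congr (cls _); apply: fa.
- by apply: etrans (hE _ _) _; congr (cls _).
- move=> m n r e i x y.
  rewrite -(clsK x) -(clsK y) [X in h r X]ccircE !hE [RHS]ccircE.
  by congr (cls _); apply: fc.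
Qed.

Lemma quotient_iso P Q (I : forall n, P n -> Prop) (J : forall n, Q n -> Prop)
    (idI : is_ideal I) (idJ : is_ideal J)
    (f : forall n, P n -> Q n) (g : forall n, Q n -> P n) :
  operad_morphism f -> operad_morphism g ->
  (forall n, cancel (f n) (g n)) -> (forall n, cancel (g n) (f n)) ->
  (forall n p, I n p -> J n (f n p)) -> (forall n q, J n q -> I n (g n q)) ->
  operad_iso (quotient_operad idI) (quotient_operad idJ).
Proof.
move=> fM gM fK gK fIJ gJI.
have [h hM hE] := quotient_morphism idI idJ fM fIJ.
have [h' _ h'E] := quotient_morphism idJ idI gM gJI.
exists h => // n; exists (h' n) => x.
- rewrite -[in RHS](clsK x) -[in LHS](clsK x).
  by apply: etrans (congr1 _ (hE _ _)) _; rewrite h'E fK.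
- rewrite -[in RHS](clsK x) -[in LHS](clsK x).
  by apply: etrans (congr1 _ (h'E _ _)) _; rewrite hE gK.
Qed.

End OperadMorphisms.

(** * Quadratic operads with isomorphic data *)

Section InducedMaps.
Context (k : fieldType).
Implicit Types V W : s2module k.

Lemma free_operad_ext V (O : operad k) (g h : forall n, free_operad V n -> O n) :
  operad_morphism g -> operad_morphism h ->
  (forall v, g 2%N (gen v) = h 2%N (gen v)) -> forall n, g n =1 h n.
Proof.
move=> gM hM gh n x; have [gl ga _ _] := gM; have [vl vf] := gen_s2linear V.
have gV : s2linear (fun v => g 2%N (gen v)).
  by split=> [a u v|v]; [rewrite vl gl | rewrite vf ga].
have [f [_ _ fU]] := free_operadP gV.
by rewrite (fU _ gM) // -(fU _ hM).
Qed.

(** Equivariance is only required on basis vectors; [s2map_flip] extends it. *)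
Definition s2map V W (f : V -> vec k W) : Prop :=
  forall i, lext f (flip_basis i) = flip (f i).

Lemma s2map_flip V W (f : V -> vec k W) : s2map f ->
  forall v, lext f (flip v) = flip (lext f v).
Proof.
move=> fV; apply: lin_ext => [a x y|a x y|i]; rewrite ?linearP //.
by rewrite [flip (bvec k i)]lext_bvec fV lext_bvec.
Qed.

Lemma free_map V W (f : V -> vec k W) : s2map f ->
  exists2 g : forall n, free_operad V n -> free_operad W n,
    operad_morphism g & forall v, g 2%N (gen v) = gen (lext f v).
Proof.
move=> fV; have [vl vf] := gen_s2linear W.
have gV : s2linear (fun v => gen (lext f v)).
  by split=> [a u v|v]; [rewrite linearP vl | rewrite s2map_flip // vf].
have [g [gM gE _]] := free_operadP gV; by exists g.
Qed.

(** The component in arity 3 of the map of free operads induced by [lext f], as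
    [free_map_tree3] shows. *)
Definition map3 V W (f : V -> vec k W) : vec3 k V -> vec3 k W :=
  lext (fun t : 'I_3 * V * V => tree t.1.1 (f t.1.2) (f t.2)).
HB.instance Definition _ V W (f : V -> vec k W) := GRing.Linear.on (map3 f).

Lemma map3_tree V W (f : V -> vec k W) c m n :
  map3 f (tree c m n) = tree c (lext f m) (lext f n).
Proof.
move: m; apply: lin_ext => [a x y|a x y|i].
- by rewrite tree_linearl linearP.
- by rewrite linearP tree_linearl.
move: n; apply: lin_ext => [a x y|a x y|j].
- by rewrite tree_linearr linearP.
- by rewrite linearP tree_linearr.
by rewrite treeb /map3 !lext_bvec.
Qed.

Lemma map3_act V W (f : V -> vec k W) s x : s2map f ->
  map3 f (act3 s x) = act3 s (map3 f x).
Proof.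
move=> fV; move: x; apply: lin_ext => [a x y|a x y|[[c i] j]]; rewrite ?linearP //.
rewrite -treeb !(map3_tree, act3_tree); congr (tree _ _ _).
by case: (odd_perm s) => //; rewrite /flipn s2map_flip.
Qed.

Lemma free_map_tree3 V W (f : V -> vec k W)
    (g : forall n, free_operad V n -> free_operad W n) :
  operad_morphism g -> (forall v, g 2%N (gen v) = gen (lext f v)) ->
  forall x, g 3%N (tree3 x) = tree3 (map3 f x).
Proof.
move=> [gl ga g1 gc] gE; apply: lin_ext => [a x y|a x y|[[c i] j]].
- by rewrite tree3_linear gl.
- by rewrite linearP tree3_linear.
by rewrite -treeb map3_tree !tree3_tree ga gc !gE.
Qed.

(** By freeness [f] and [g] extend to inverse isomorphisms of free operads.  The
    relations are exchanged in arity 3, hence so are the ideals that they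
    generate, because the preimage of an ideal by a morphism is an ideal. *)
Lemma quadratic_operad_iso (P Q : quadratic_data k)
    (f : gens Q -> vec k (gens P)) (g : gens P -> vec k (gens Q)) :
  s2map f -> (forall i, lext g (f i) = bvec k i) ->
  (forall j, lext f (g j) = bvec k j) ->
  (linfun (map3 f) @: rels Q)%VS = rels P ->
  operad_iso (quadratic_operad P) (quadratic_operad Q).
Proof.
move=> fV fK gK fR.
have lfK : cancel (lext f) (lext g).
  by apply: lin_ext => [a x y|a x y|i]; rewrite ?linearP // lext_bvec fK.
have lgK : cancel (lext g) (lext f).
  by apply: lin_ext => [a x y|a x y|j]; rewrite ?linearP // lext_bvec gK.
have gV : s2map g.
  move=> j; rewrite -[RHS]lfK; congr (lext g _).
  by rewrite s2map_flip // gK [RHS]lext_bvec.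
have [F FM FE] := free_map fV; have [G GM GE] := free_map gV.
have FK n : cancel (F n) (G n).
  apply: (free_operad_ext (morphism_comp FM GM) (@morphism_id k _)) => v.
  by rewrite FE GE lfK.
have GK n : cancel (G n) (F n).
  apply: (free_operad_ext (morphism_comp GM FM) (@morphism_id k _)) => v.
  by rewrite GE FE lgK.
apply: (quotient_iso _ _ GM FM GK FK) => n p Ip.
- apply: (Ip _ (preimage_ideal GM (ideal_gen_ideal _))).
  move=> q [y]; rewrite -fR => /memv_imgP[x xP ->] -> I idI; apply.
  by rewrite lfunE /= -(free_map_tree3 FM FE) FK; exists x.
- apply: (Ip _ (preimage_ideal FM (ideal_gen_ideal _))).
  move=> _ [x xP ->] I idI; apply; rewrite (free_map_tree3 FM FE).
  by exists (map3 f x); rewrite // -fR -[map3 f x]lfunE memv_img.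
Qed.

End InducedMaps.

(** * The symmetric group on three letters *)

Section Symmetric3.

Lemma ord3P (p : 'I_3) : [\/ p = 0, p = 1 | p = 2%:R].
Proof.
by case: p => [[|[|[|//]]] i3]; [constructor 1|constructor 2|constructor 3];
  apply: val_inj.
Qed.

(** The permutations of Z/3 are the affine bijections, the even ones being the
    translations: the transposition of a and b is c |-> a + b - c. *)
Lemma perm3_affine (s : 'S_3) (c : 'I_3) :
  s c = s 0 + (if odd_perm s then - c else c).
Proof.
have [ts -> dts] := prod_tpermP s; elim: ts dts c => [_|[a b] ts IH] /= => [c|].
  by rewrite big_nil odd_perm1 !perm1 add0r.
case/andP=> ab dts c; rewrite big_cons odd_mul_tperm ab !permM.
rewrite (IH dts (tperm a b c)) (IH dts (tperm a b 0)).
set e := odd_perm _; set d := _ 0.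
rewrite -addrA; congr (d + _).
move: a b c ab => [[|[|[|//]]] ?] [[|[|[|//]]] ?] [[|[|[|//]]] ?] // _; case: e;
  apply/val_inj; rewrite !permE //=.
Qed.

Lemma perm3P (s : 'S_3) : (s 0, s 1, s 2%:R, odd_perm s) \in
  [:: (0, 1, 2%:R, false); (1, 2%:R, 0, false); (2%:R, 0, 1, false);
      (0, 2%:R, 1, true); (1, 0, 2%:R, true); (2%:R, 1, 0, true)].
Proof.
rewrite (perm3_affine s 1) (perm3_affine s 2%:R).
by case: (odd_perm s); case: (s 0) => [[|[|[|//]]] i3].
Qed.

Lemma xyzE : (((xyz 0 = 0) * (xyz 1 = 1)) *
  ((xyz 2%:R = 2%:R) * (odd_perm xyz = false)))%type.
Proof. by rewrite /xyz !perm1 odd_perm1. Qed.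

Lemma xzyE : (((xzy 0 = 0) * (xzy 1 = 2%:R)) *
  ((xzy 2%:R = 1) * (odd_perm xzy = true)))%type.
Proof. by rewrite /xzy odd_tperm tpermD // tpermL tpermR. Qed.

Lemma perm3_ex (c : 'I_3) (b : bool) :
  exists2 s : 'S_3, s 0 = c & odd_perm s = b.
Proof.
exists ((if odd_perm (tperm 0 c) == b then 1 else xzy) * tperm 0 c)%g.
  by rewrite permM; case: ifP; rewrite ?perm1 ?xzyE tpermL.
rewrite odd_permM; case: ifP => [/eqP<-|]; rewrite ?odd_perm1 ?xzyE //.
by case: b (odd_perm _) => [] [].
Qed.

End Symmetric3.

(** * Spaces of relations *)

Section SpanRelations.
Context (k : fieldType).
Implicit Types V W : s2module k.

HB.instance Definition _ (I J : finType) (u : vec k I) :=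
  GRing.isLinear.Build k _ _ _ (@tens k I J u) (@tens_linearr k I J u).

(** A name for the tensor product with its arguments exchanged, to which the
    linearity in the left factor can be attached. *)
Definition tensr (I J : finType) (v : vec k J) (u : vec k I) := tens u v.
HB.instance Definition _ (I J : finType) (v : vec k J) :=
  GRing.isLinear.Build k _ _ _ (@tensr I J v) (@tens_linearl k I J v).

Lemma span3_sub V (rs : seq (vec3 k V)) (X : {vspace vec3 k V}) :
  (forall s r, r \in rs -> act3 s r \in X) -> (span3 rs <= X)%VS.
Proof.
move=> rsX; apply/span_subvP=> _ /allpairsP[[s r] [/= _ rrs ->]].
exact: rsX.
Qed.

Lemma span3_rel V (rs : seq (vec3 k V)) s r :
  r \in rs -> act3 s r \in span3 rs.
Proof. by move=> rrs; apply: memv_span; apply: allpairs_f; rewrite ?mem_enum. Qed.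

(** Since Psi is equivariant up to sign, Psi(r.s (x) r'.t) is, up to sign, the
    image under s of Psi(r (x) r'.(t s^-1)): only one of the two relators has to
    be permuted. *)
Lemma black_rels_sub V W (rs : seq (vec3 k V)) (ss : seq (vec3 k W))
    (X : {vspace vec3 k (tens_module (tens_module V W) (sgn_module k))}) :
  (forall s x, x \in X -> act3 s x \in X) ->
  (forall t r r', r \in rs -> r' \in ss -> Psi (tens r (act3 t r')) \in X) ->
  (black_rels (presented rs) (presented ss) <= X)%VS.
Proof.
move=> XS rX; apply/subvP=> _ /memv_imgP[y yR ->].
rewrite memv_preim; move: y yR; apply/subvP; apply: tensv_sub => u v /= uR vR.
rewrite -memv_preim lfunE /=.
pose L := (linfun (@Psi k V W) \o linfun (tens u))%VF.
have -> : Psi (tens u v) = L v by rewrite /L comp_lfunE !lfunE.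
rewrite memv_preim; move: v vR; apply/subvP; apply: span3_sub => t r' r'ss.
rewrite -memv_preim /L comp_lfunE !lfunE /= {L}.
pose M := (linfun (@Psi k V W) \o linfun (tensr (act3 t r')))%VF.
have -> : Psi (tens u (act3 t r')) = M u by rewrite /M comp_lfunE !lfunE.
rewrite memv_preim; move: u uR; apply/subvP; apply: span3_sub => s r rrs.
rewrite -memv_preim /M comp_lfunE !lfunE /= {M}.
have -> : tensr (act3 t r') (act3 s r) = act33 s (tens r (act3 (t * s^-1)%g r')).
  by rewrite act33_tens act3M mulgKV.
have -> : Psi (act33 s (tens r (act3 (t * s^-1)%g r')))
    = (-1) ^+ odd_perm s *: act3 s (Psi (tens r (act3 (t * s^-1)%g r'))).
  by rewrite Psi_act scalerA -expr2 sqrr_sign scale1r.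
by apply: rpredZ; apply: XS; apply: rX.
Qed.

Lemma act3_1 V (x : vec3 k V) : act3 1%g x = x.
Proof.
move: x; apply: lin_ext => [a u v|a u v|[[c i] j]]; rewrite ?linearP //.
by rewrite -treeb act3_tree perm1 odd_perm1.
Qed.

Lemma span3_gen V (rs : seq (vec3 k V)) r : r \in rs -> r \in span3 rs.
Proof. by move=> rrs; rewrite -[r]act3_1; apply: span3_rel. Qed.

Lemma black_rels_mem V W (rs : seq (vec3 k V)) (ss : seq (vec3 k W)) t r r' :
  r \in rs -> r' \in ss ->
  Psi (tens r (act3 t r')) \in black_rels (presented rs) (presented ss).
Proof.
move=> rrs rss; rewrite -[Psi _](lfunE (@Psi k V W)); apply: memv_img.
by apply: mem_tensv; [apply: span3_gen | apply: span3_rel].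
Qed.

End SpanRelations.

(** * Signed sums of basis vectors *)

Section SignedSums.
Context (k : fieldType).
Implicit Types I J : finType.

(** All the relators are sums of basis vectors with coefficients 1 and -1; the
    flag [true] stands for -1.  With such sums given by lists, the maps between
    spaces of relations act on lists, and identities between relators are
    checked by comparing lists up to permutation ([comb_perm]). *)
Definition comb I (l : seq (bool * I)) : vec k I :=
  \sum_(x <- l) (-1) ^+ x.1 *: bvec k x.2.

Definition signed_map I J (e : I -> bool) (f : I -> J) (i : I) : vec k J :=
  (-1) ^+ e i *: bvec k (f i).

Definition map_comb I J (e : I -> bool) (f : I -> J) (l : seq (bool * I)) :=
  [seq (x.1 (+) e x.2, f x.2) | x <- l].

Lemma comb1 I (i : I) : bvec k i = comb [:: (false, i)].
Proof. by rewrite /comb big_seq1 scale1r. Qed.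

Lemma combD I (l l' : seq (bool * I)) : comb l + comb l' = comb (l ++ l').
Proof. by rewrite /comb big_cat. Qed.

Lemma combN I (l : seq (bool * I)) : - comb l = comb [seq (~~ x.1, x.2) | x <- l].
Proof.
rewrite /comb big_map raddf_sum; apply: eq_bigr => x _.
by case: x.1; rewrite /= ?scale1r ?scaleN1r ?opprK.
Qed.

Lemma comb_perm I (l l' : seq (bool * I)) : perm_eq l l' -> comb l = comb l'.
Proof. exact: perm_big. Qed.

Lemma linear_comb I (U : lmodType k) (h : vec k I -> U) : linear h ->
  forall l, h (comb l) = \sum_(x <- l) (-1) ^+ x.1 *: h (bvec k x.2).
Proof.
move=> hl; pose H := GRing.isLinear.Build k _ _ _ h hl.
pose h' : {linear vec k I -> U} := HB.pack h H.
move=> l; rewrite -[h _]/(h' _) linear_sum; apply: eq_bigr => x _.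
exact: linearZ.
Qed.

Lemma signed_linear_comb I J (h : vec k I -> vec k J) (e : I -> bool) (f : I -> J) :
  linear h -> (forall i, h (bvec k i) = signed_map e f i) ->
  forall l, h (comb l) = comb (map_comb e f l).
Proof.
move=> hl hE l; rewrite (linear_comb hl) /comb big_map; apply: eq_bigr => x _.
by rewrite hE scalerA signr_addb.
Qed.

Lemma tens_comb I J (l : seq (bool * I)) (l' : seq (bool * J)) :
  tens (comb l) (comb l') =
  comb [seq (x.1 (+) y.1, (x.2, y.2)) | x <- l, y <- l'].
Proof.
rewrite (linear_comb (@tens_linearl k I J (comb l'))) /comb big_allpairs_dep.
apply: eq_bigr => x _; rewrite (linear_comb (@tens_linearr k I J _)) scaler_sumr.
by apply: eq_bigr => y _; rewrite tens_bvec scalerA signr_addb.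
Qed.

End SignedSums.

(** * Action on monomials *)

Section MonomialMaps.
Context (k : fieldType).
Implicit Types V W : s2module k.

Notation smono V := (seq (bool * ('I_3 * basis V * basis V))).

Lemma tensZl (I J : finType) (v : vec k J) a (x : vec k I) :
  tens (a *: x) v = a *: tens x v.
Proof. exact: (linearZ_LR (tensr v)). Qed.

Lemma tensZr (I J : finType) (u : vec k I) a (x : vec k J) :
  tens u (a *: x) = a *: tens u x.
Proof. exact: (linearZ_LR (tens u)). Qed.

Lemma treeZ (V : s2module k) c a b (x y : vec k V) :
  tree c (a *: x) (b *: y) = a *: (b *: tree c x y).
Proof. by rewrite /tree !tensZr tensZl scalerA mulrC -scalerA. Qed.

Lemma act3_free g s (l : smono (free_module k g)) :
  act3 s (comb k l) =
  comb k (map_comb (fun=> false)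
    (fun t : 'I_3 * free_module k g * free_module k g =>
      (s t.1.1, t.1.2, (t.2.1, odd_perm s (+) t.2.2))) l).
Proof.
apply: signed_linear_comb; first exact: linearP.
move=> [[c i] j]; rewrite -treeb act3_tree /signed_map scale1r -treeb; congr tree.
by case: j => j b; case: (odd_perm s); rewrite ?[LHS]lext_bvec.
Qed.

Lemma act3_trivial s (l : smono (trivial_module k)) :
  act3 s (comb k l) =
  comb k (map_comb (fun=> false)
    (fun t : 'I_3 * trivial_module k * trivial_module k =>
      (s t.1.1, t.1.2, t.2)) l).
Proof.
apply: signed_linear_comb; first exact: linearP.
move=> [[c i] j]; rewrite -treeb act3_tree /signed_map scale1r -treeb; congr tree.
by case: j; case: (odd_perm s); rewrite ?[LHS]lext_bvec.
Qed.

Lemma map3_comb V W (e : V -> bool) (f : V -> W) (l : smono V) :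
  map3 (signed_map k e f) (comb k l) =
  comb k (map_comb (fun t => e t.1.2 (+) e t.2)
                   (fun t => (t.1.1, f t.1.2, f t.2)) l).
Proof.
apply: signed_linear_comb; first exact: linearP.
move=> [[c i] j]; rewrite -treeb map3_tree !lext_bvec treeZ treeb.
by rewrite scalerA -signr_addb.
Qed.

Lemma Psi_comb V W (l : seq (bool * (('I_3 * V * V) * ('I_3 * W * W)))) :
  Psi (comb k l) =
  comb k [seq (x.1, (x.2.1.1.1, (x.2.1.1.2, x.2.2.1.2, tt),
                                (x.2.1.2, x.2.2.2, tt)))
         | x <- l & x.2.1.1.1 == x.2.2.1.1].
Proof.
rewrite (linear_comb (@linearP _ _ _ _ (@Psi k V W))) /comb big_map big_filter.
rewrite [RHS]big_mkcond; apply: eq_bigr => -[b [[[c i] j] [[d i'] j']]] _ /=.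
rewrite {1}/Psi lext_bvec !tens_bvec treeb.
by case: eqP => _; rewrite ?scale1r // scale0r scaler0.
Qed.

Lemma Phi_comb V W (l : smono (tens_module V W)) :
  Phi (comb k l) =
  comb k (map_comb (fun=> false)
    (fun t : 'I_3 * (V * W) * (V * W) =>
       ((t.1.1, t.1.2.1, t.2.1), (t.1.1, t.1.2.2, t.2.2))) l).
Proof.
apply: signed_linear_comb; first exact: linearP.
move=> [[c [i i']] [j j']].
by rewrite /Phi lext_bvec !treeb tens_bvec /signed_map scale1r.
Qed.

(** The inverse of a signed bijection of bases is again a signed bijection, and
    equivariance reduces one of the inclusions of relations to the relators. *)
Lemma signed_presented_iso (P : quadratic_data k) U (rs : seq (vec3 k U))
    (e : U -> bool) (f : U -> gens P) (g : gens P -> U) :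
  s2map (signed_map k e f) -> cancel f g -> cancel g f ->
  (forall r, r \in rs -> map3 (signed_map k e f) r \in rels P) ->
  (rels P <= linfun (map3 (signed_map k e f)) @: span3 rs)%VS ->
  operad_iso (quadratic_operad P) (quadratic_operad (presented rs)).
Proof.
move=> fV fK gK rP Pr.
apply: (@quadratic_operad_iso _ P (presented rs) _ (signed_map k (e \o g) g) fV).
- by move=> i; rewrite linearZ /= lext_bvec /signed_map /= fK signrZK.
- by move=> j; rewrite linearZ /= lext_bvec /signed_map /= gK signrZK.
apply/eqP; rewrite eqEsubv Pr andbT.
apply/subvP=> _ /memv_imgP[x xr ->].
rewrite memv_preim; move: x xr; apply/subvP/span3_sub => s r rrs.
by rewrite -memv_preim lfunE /= map3_act // rels_stable ?rP.
Qed.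

Lemma signed_black_iso V W U (rs : seq (vec3 k V)) (ss : seq (vec3 k W))
    (us : seq (vec3 k U)) (e : U -> bool)
    (f : U -> tens_module (tens_module V W) (sgn_module k))
    (g : tens_module (tens_module V W) (sgn_module k) -> U) :
  s2map (signed_map k e f) -> cancel f g -> cancel g f ->
  (forall u, u \in us ->
     map3 (signed_map k e f) u \in black_rels (presented rs) (presented ss)) ->
  (forall t r r', r \in rs -> r' \in ss -> exists2 u, u \in span3 us &
     Psi (tens r (act3 t r')) = map3 (signed_map k e f) u) ->
  operad_iso (quadratic_operad (black (presented rs) (presented ss)))
             (quadratic_operad (presented us)).
Proof.
move=> fV fK gK uR Ru.
refine (@signed_presented_iso (black (presented rs) (presented ss)) U us e f g
  fV fK gK uR _).
apply: black_rels_sub => [s _ /memv_imgP[x xu ->]|t r r' rrs rss].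
  rewrite lfunE /= -map3_act // -[map3 _ _]lfunE memv_img //.
  exact: span3_stable.
by have [u uu ->] := Ru t r r' rrs rss; rewrite -[map3 _ _]lfunE memv_img.
Qed.

End MonomialMaps.

(** * Pre-Lie and associative algebras give dendriform algebras *)

Section Relators.
Context (k : fieldType).

Lemma flip_free g (i : free_module k g) :
  flip (bvec k i) = bvec k ((i.1, ~~ i.2) : free_module k g).
Proof. exact: lext_bvec. Qed.

Lemma lcomb_free g (i j : free_module k g) s :
  lcomb (bvec k i) (bvec k j) s =
  comb k [:: (false, (s 2%:R, i, (j.1, odd_perm s (+) j.2)))].
Proof. by rewrite /lcomb treeb comb1 act3_free. Qed.

Lemma rcomb_free g (i j : free_module k g) s :
  rcomb (bvec k i) (bvec k j) s =
  comb k [:: (false, (s 0, (i.1, ~~ i.2), (j.1, odd_perm s (+) j.2)))].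
Proof. by rewrite /rcomb flip_free treeb comb1 act3_free. Qed.

Local Notation F1 := (free_module k 1).
Local Notation F2 := (free_module k 2).
(* The entry for the monomial m(n(x_(c+1), x_(c+2)), x_c), where m and n are the
   product or, if the flag is true, the opposite product; s is its sign. *)
Local Notation m1 s c a b := (s, ((c : 'I_3), ((0, a) : F1), ((0, b) : F1))).
Local Notation m2 s c i a j b := (s, ((c : 'I_3), ((i, a) : F2), ((j, b) : F2))).
Local Notation ct s c :=
  (s, ((c : 'I_3), (tt : trivial_module k), (tt : trivial_module k))).

Definition prelie_rel :=
  [:: m1 false 2%:R false false; m1 true 0 true false;
      m1 true 1 false true; m1 false 0 true true].
Definition as_rel := [:: m1 false 2%:R false false; m1 true 0 true false].
Definition com_rel := [:: ct false 2%:R; ct true 0].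
Definition zinb_rel :=
  [:: m1 false 2%:R false false; m1 true 0 true false; m1 true 0 true true].

(** In x < y the dominant variable is x, and in x > y it is y.  Numbered from
    0, relation [p] consists of monomials that are dominated by the variable in
    place [p]. *)
Definition dend_rel (p : 'I_3) := nth [::]
  [:: [:: m2 false 2%:R 0 false 0 false; m2 true 0 0 true 0 false;
          m2 true 0 0 true 1 false];
      [:: m2 false 2%:R 0 false 1 false; m2 true 0 1 true 0 false];
      [:: m2 false 2%:R 1 false 0 false; m2 false 2%:R 1 false 1 false;
          m2 true 0 1 true 1 false]] p.

Lemma PreLie_dataE : PreLie_data k = presented [:: comb k prelie_rel].
Proof.
by rewrite /PreLie_data /oper !lcomb_free !rcomb_free !xyzE !xzyE !(combN, combD).
Qed.

Lemma As_dataE : As_data k = presented [:: comb k as_rel].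
Proof.
by rewrite /As_data /oper !lcomb_free !rcomb_free !xyzE !(combN, combD).
Qed.

Lemma Zinb_dataE : Zinb_data k = presented [:: comb k zinb_rel].
Proof.
by rewrite /Zinb_data /oper !lcomb_free !rcomb_free !xyzE !xzyE !(combN, combD).
Qed.

Lemma Dend_dataE : Dend_data k = presented
  [:: comb k (dend_rel 0); comb k (dend_rel 1); comb k (dend_rel 2%:R)].
Proof.
by rewrite /Dend_data /oper !lcomb_free !rcomb_free !xyzE !(combN, combD).
Qed.

Lemma Com_dataE : Com_data k = presented [:: comb k com_rel].
Proof.
rewrite /Com_data /lcomb /rcomb [flip _]lext_bvec !treeb !comb1 !act3_trivial.
by rewrite /= !xyzE combN combD.
Qed.

(** Let m be the pre-Lie product, u the associative one, and let a prime mark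
    the opposite of an operation.  With the signs of [dend_map], the operations
    <, <', >, >' go to m u, - m' u', - m' u, m u'; a sign appears exactly when m
    is replaced by m', because of the signature factor of the black product. *)
Definition dend_gen (x : F2) :
    tens_module (tens_module F1 F1) (sgn_module k) :=
  ((0, odd x.1 (+) x.2, (0, x.2)), tt).
Definition dend_gen_inv (y : tens_module (tens_module F1 F1) (sgn_module k)) : F2 :=
  (inord (y.1.1.2 (+) y.1.2.2), y.1.2.2).
Definition dend_map := signed_map k (fun x : F2 => odd x.1 (+) x.2) dend_gen.

Lemma dend_genK : cancel dend_gen dend_gen_inv.
Proof.
move=> [[[|[|//]] i2] b]; rewrite /dend_gen_inv /=; congr (_, _);
  by apply: val_inj; rewrite /= inordK //; case: b.
Qed.

Lemma dend_gen_invK : cancel dend_gen_inv dend_gen.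
Proof.
by move=> [[[a0 a] [b0 b]] []]; rewrite /dend_gen /= inordK ?(ord1 a0) ?(ord1 b0);
  case: a; case: b.
Qed.

Lemma flip_sgn_tens (V : s2module k) (x : vec k V) (i : sgn_module k) :
  @flip k (tens_module V (sgn_module k)) (tens x (bvec k i)) =
  - tens (flip x) (bvec k i).
Proof.
by rewrite flip_tens -[flip (bvec k i)]/(flipn true _) flipn_sgn tensZr scaleN1r.
Qed.

Lemma dend_map_s2map : s2map dend_map.
Proof.
have flipE (x y : F1) (u : sgn_module k) :
    @flip k (tens_module (tens_module F1 F1) (sgn_module k)) (bvec k (x, y, u)) =
    - bvec k (((x.1, ~~ x.2) : F1), ((y.1, ~~ y.2) : F1), u).
  rewrite -[bvec k (x, y, u)]tens_bvec -[bvec k (x, y)]tens_bvec.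
  by rewrite flip_sgn_tens flip_tens !flip_free !tens_bvec.
move=> [i b]; rewrite lext_bvec /dend_map /signed_map linearZ_LR /dend_gen /=.
rewrite flipE /=.
by rewrite addbN signrN scalerN scaleNr.
Qed.

(** The hypothesis says that x_0, the variable which is first in each monomial
    of the pre-Lie relator, is in place [p] of the permuted associator. *)
Lemma Psi_prelie_as (t : 'S_3) (p : 'I_3) : t p = 0 ->
  Psi (tens (comb k prelie_rel) (act3 t (comb k as_rel))) =
  map3 dend_map (act3 t (comb k (dend_rel p))).
Proof.
(* Each of the six permutations determines [p] and makes both lists explicit. *)
move=> tp; rewrite !act3_free tens_comb Psi_comb map3_comb.
apply: comb_perm; have := perm3P t; rewrite !inE; move: tp.
case: (ord3P p) => -> t0.
all: do 5 ?[case/orP]; move/eqP; case=> E0 E1 E2 Eo.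
all: rewrite ?E0 ?E1 ?E2 // in t0.
all: by rewrite /= !(E0, E1, E2, Eo).
Qed.

Lemma mem_dend_rels p : comb k (dend_rel p) \in
  [:: comb k (dend_rel 0); comb k (dend_rel 1); comb k (dend_rel 2%:R)].
Proof. by case: (ord3P p) => ->; rewrite !inE eqxx ?orbT. Qed.

Lemma PreLie_As_Dend :
  operad_iso (quadratic_operad (black (PreLie_data k) (As_data k)))
             (quadratic_operad (Dend_data k)).
Proof.
rewrite PreLie_dataE As_dataE Dend_dataE.
apply: (signed_black_iso dend_map_s2map dend_genK dend_gen_invK).
  have dB (p : 'I_3) : map3 dend_map (comb k (dend_rel p)) \in
      black_rels (presented [:: comb k prelie_rel])
                 (presented [:: comb k as_rel]).
    have t0 : tperm 0 p p = 0 by rewrite tpermR.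
    rewrite -(act3_1 (comb k _)) -(mulgV (tperm 0 p)) -act3M map3_act;
      last exact: dend_map_s2map.
    rewrite -(Psi_prelie_as t0); apply: black_stable.
    by apply: black_rels_mem; rewrite mem_head.
  by move=> u; rewrite !inE => /or3P[] /eqP->; apply: dB.
move=> t r r'; rewrite !inE => /eqP-> /eqP->.
exists (act3 t (comb k (dend_rel (t^-1%g 0)))).
  exact/span3_rel/mem_dend_rels.
by apply: Psi_prelie_as; rewrite permKV.
Qed.

End Relators.

(** * Pre-Lie and commutative algebras give Zinbiel algebras *)

Section Zinbiel.
Context (k : fieldType).
Local Notation F1 := (free_module k 1).

Definition zinb_gen (x : F1) :
    tens_module (tens_module F1 (trivial_module k)) (sgn_module k) := (x, tt, tt).
Definition zinb_map := signed_map k (fun x : F1 => x.2) zinb_gen.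

Lemma zinb_genK : cancel zinb_gen (fun y => y.1.1).
Proof. by []. Qed.

Lemma zinb_gen_invK : cancel (fun y => y.1.1) zinb_gen.
Proof. by move=> [[x []] []]. Qed.

Lemma zinb_map_s2map : s2map zinb_map.
Proof.
have flipE (x : F1) (i : trivial_module k) (u : sgn_module k) :
    @flip k (tens_module (tens_module F1 (trivial_module k)) (sgn_module k))
      (bvec k (x, i, u)) = - bvec k (((x.1, ~~ x.2) : F1), i, u).
  rewrite -[bvec k (x, i, u)]tens_bvec -[bvec k (x, i)]tens_bvec.
  rewrite flip_sgn_tens flip_tens !flip_free [flip (bvec k i)]lext_bvec.
  by case: i; rewrite !tens_bvec.
move=> [i b]; rewrite lext_bvec /zinb_map /signed_map linearZ_LR /zinb_gen /=.
rewrite flipE /=.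
by rewrite signrN scalerN scaleNr.
Qed.

Lemma Psi_prelie_com (t : 'S_3) : t \in [:: 1%g; xzy] ->
  Psi (tens (comb k (prelie_rel k)) (act3 t (comb k (com_rel k)))) =
  map3 zinb_map (act3 t (comb k (zinb_rel k))).
Proof.
move=> t1; rewrite act3_free act3_trivial tens_comb Psi_comb map3_comb.
apply: comb_perm; move: t1; rewrite !inE => /orP[]/eqP->;
  by rewrite /= ?xyzE ?xzyE.
Qed.

(** The orbit consists of the differences of two of the three monomials X_0,
    X_1, X_2 on a commutative product, and X_2 - X_0 and X_1 - X_0 generate
    them. *)
Lemma com_rel_orbit (t : 'S_3) : exists a b : k,
  act3 t (comb k (com_rel k)) =
  a *: act3 1%g (comb k (com_rel k)) + b *: act3 xzy (comb k (com_rel k)).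
Proof.
pose X c := comb k
  [:: (false, (c : 'I_3, tt : trivial_module k, tt : trivial_module k))].
have XE (s : 'S_3) : act3 s (comb k (com_rel k)) = X (s 2%:R) - X (s 0).
  by rewrite act3_trivial combN combD.
rewrite !XE !perm1 !xzyE.
have XB c : exists a b : k, X c - X 0 = a *: (X 2%:R - X 0) + b *: (X 1 - X 0).
  case: (ord3P c) => ->; [exists 0, 0|exists 0, 1|exists 1, 0];
    by rewrite ?scale0r ?scale1r ?addr0 ?add0r ?subrr.
have [a [b Ea]] := XB (t 2%:R); have [a' [b' Eb]] := XB (t 0).
exists (a - a'), (b - b'); rewrite !scalerBl addrACA -opprD -Ea -Eb.
by rewrite opprB addrA subrK.
Qed.

Lemma PreLie_Com_Zinb :
  operad_iso (quadratic_operad (black (PreLie_data k) (Com_data k)))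
             (quadratic_operad (Zinb_data k)).
Proof.
rewrite PreLie_dataE Com_dataE Zinb_dataE.
apply: (signed_black_iso zinb_map_s2map zinb_genK zinb_gen_invK).
  move=> u; rewrite !inE => /eqP->; rewrite -(act3_1 (comb k _)).
  rewrite -Psi_prelie_com ?inE ?eqxx //.
  by apply: black_rels_mem; rewrite mem_head.
move=> t r r'; rewrite !inE => /eqP-> /eqP->.
have [a [b ->]] := com_rel_orbit t.
exists (a *: act3 1%g (comb k (zinb_rel k)) +
        b *: act3 xzy (comb k (zinb_rel k))).
  by apply: rpredD; apply: rpredZ; apply: span3_rel; rewrite mem_head.
rewrite tens_linearr linearP /= tensZr linearZ_LR /=.
rewrite linearP /= linearZ_LR /=.
by rewrite !Psi_prelie_com ?inE ?eqxx ?orbT.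
Qed.

End Zinbiel.

(** * Permutative and Lie algebras give Leibniz algebras *)

Section Leibniz.
Context (k : fieldType).
Local Notation F1 := (free_module k 1).
Local Notation L1 := (sgn_module k).
Local Notation m1 s c a b := (s, ((c : 'I_3), ((0, a) : F1), ((0, b) : F1))).
Local Notation br s c := (s, ((c : 'I_3), (tt : L1), (tt : L1))).

Definition perm_rel1 := [:: m1 false 2%:R false false; m1 true 0 true false].
Definition perm_rel2 := [:: m1 false 0 true false; m1 true 0 true true].
Definition jacobi_rel := [:: br false 2%:R; br false 0; br false 1].
Definition leib_rel :=
  [:: m1 false 0 true false; m1 true 2%:R false false; m1 false 1 false true].

Lemma Perm_dataE :
  Perm_data k = presented [:: comb k perm_rel1; comb k perm_rel2].
Proof.
by rewrite /Perm_data /oper !lcomb_free !rcomb_free !xyzE !xzyE !(combN, combD).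
Qed.

Lemma Lie_dataE : Lie_data k = presented [:: comb k jacobi_rel].
Proof. by rewrite /Lie_data !treeb !comb1 !combD. Qed.
Lemma Leib_dataE : Leib_data k = presented [:: comb k leib_rel].
Proof.
by rewrite /Leib_data /oper !lcomb_free !rcomb_free !xyzE !xzyE !(combN, combD).
Qed.


Definition leib_gen (x : F1) : tens_module F1 L1 := (x, tt).
Definition leib_map := signed_map k (fun x : F1 => x.2) leib_gen.

Lemma leib_genK : cancel leib_gen fst.
Proof. by []. Qed.

Lemma leib_gen_invK : cancel fst leib_gen.
Proof. by move=> [x []]. Qed.

Lemma leib_map_s2map : s2map leib_map.
Proof.
move=> [i b]; rewrite lext_bvec /leib_map /signed_map linearZ_LR /leib_gen /=.
rewrite -[bvec k ((i, b) : F1, tt : L1)]tens_bvec flip_sgn_tens flip_free.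
rewrite tens_bvec /=.
by rewrite signrN scalerN scaleNr.
Qed.

Lemma act3_jacobi (s : 'S_3) :
  act3 s (comb k jacobi_rel) = (-1) ^+ odd_perm s *: comb k jacobi_rel.
Proof.
have sE t : act3 s (bvec k t) = signed_map k (fun=> odd_perm s)
    (fun t : 'I_3 * L1 * L1 => (s t.1.1, t.1.2, t.2)) t.
  case: t => -[c i] j.
  by rewrite -treeb act3_tree flipn_sgn /tree tensZr !tens_bvec.
rewrite (signed_linear_comb (@linearP _ _ _ _ (@act3 k L1 s)) sE).
have -> : (-1) ^+ odd_perm s *: comb k jacobi_rel =
    comb k (map_comb (fun=> odd_perm s) id jacobi_rel).
  rewrite /comb big_map scaler_sumr; apply: eq_bigr => x _.
  by rewrite scalerA -signr_addb addbC.
apply: comb_perm; have := perm3P s; rewrite !inE.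
by do 5 ?[case/orP]; move/eqP; case=> E0 E1 E2 Eo;
  rewrite /= !(E0, E1, E2, Eo).
Qed.

(** The index of the variable that is written first in a monomial: it separates
    the three elements of the basis of Perm in arity 3. *)
Definition first_var (t : 'I_3 * F1 * F1) : 'I_3 :=
  if t.1.2.2 then t.1.1 else if t.2.2 then t.1.1 + 2%:R else t.1.1 + 1.

Lemma first_perm_rels (u : vec3 k F1) :
  u \in span3 [:: comb k perm_rel1; comb k perm_rel2] ->
  lext (signed_map k (fun=> false) first_var) u = 0.
Proof.
pose h := lext (signed_map k (fun=> false) first_var).
have cancel2 (i j : 'I_3) : i == j -> comb k [:: (false, i); (true, j)] = 0.
  by move/eqP->; rewrite /comb big_cons big_seq1 scale1r scaleN1r subrr.
rewrite -[lext _ u]/(h u) -[h u]lfunE => uR; apply/eqP; rewrite -memv_ker.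
move: u uR.
apply/subvP/span3_sub => s r; rewrite !inE memv_ker lfunE /= => rr.
have hE := signed_linear_comb (@linearP _ _ _ _ h) (lext_bvec _).
have := perm3P s; rewrite !inE.
case/orP: rr => /eqP->; rewrite act3_free hE.
all: do 5 ?[case/orP]; move/eqP; case=> E0 E1 E2 Eo.
all: rewrite /= /first_var /= !(E0, E1, E2, Eo) /=; apply/eqP.
all: by apply: cancel2.
Qed.

(** Modulo the Jacobi relator, which is the sum of the three monomials of Lie in
    arity 3, only the differences of coordinates make sense; the coordinate c of
    this map is the difference of the coefficients number c and c - 1. *)
Definition bracket_diff (t : 'I_3 * L1 * L1) : vec k 'I_3 :=
  bvec k t.1.1 - bvec k (t.1.1 + 1).

Lemma bracket_diff_jacobi (v : vec3 k L1) :
  v \in span3 [:: comb k jacobi_rel] -> lext bracket_diff v = 0.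
Proof.
pose h := lext bracket_diff.
rewrite -[lext _ v]/(h v) -[h v]lfunE => vR; apply/eqP; rewrite -memv_ker.
move: v vR.
apply/subvP/span3_sub => s r; rewrite !inE memv_ker lfunE /= => /eqP->.
rewrite act3_jacobi linearZ_LR /= (linear_comb (@linearP _ _ _ _ h)).
rewrite !big_cons big_nil /=.
have dE (c d : 'I_3) : d = c + 1 ->
    (-1) ^+ false *: h (bvec k (c, tt : L1, tt : L1)) = bvec k c - bvec k d.
  by move=> ->; rewrite scale1r /h lext_bvec.
have telescope (V : zmodType) (x y z a b c : V) :
    a = z - x -> b = x - y -> c = y - z -> a + (b + (c + 0)) = 0.
  by move=> -> -> ->; rewrite addr0 !subrKA subrr.
rewrite (telescope _ _ _ _ _ _ _ (dE 2%:R 0 _) (dE 0 1 _) (dE 1 2%:R _))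
  ?scaler0 //; exact: val_inj.
Qed.

(** Maps defined on F(V)(3)/R and F(W)(3)/S have a tensor product that is
    defined on the quotient by R (x) F(W)(3) + F(V)(3) (x) S. *)
Lemma white_rels_eval (V W : s2module k) (I J : finType)
    (rs : seq (vec3 k V)) (ss : seq (vec3 k W))
    (a : 'I_3 * V * V -> vec k I) (b : 'I_3 * W * W -> vec k J) x :
  (forall u, u \in span3 rs -> lext a u = 0) ->
  (forall v, v \in span3 ss -> lext b v = 0) ->
  x \in white_rels (presented rs) (presented ss) ->
  lext (fun p => tens (a p.1) (b p.2)) (Phi x) = 0.
Proof.
move=> aR bS; rewrite /white_rels -memv_preim lfunE /=; move: (Phi x) => z zRS.
pose h := lext (fun p : ('I_3 * V * V) * ('I_3 * W * W) =>
  tens (a p.1) (b p.2)).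
rewrite -[lext _ z]/(h z) -[h z]lfunE; apply/eqP; rewrite -memv_ker; move: z zRS.
have t0l (v : vec k J) : tens (0 : vec k I) v = 0 := linear0 (tensr v).
have t0r (u : vec k I) : tens u (0 : vec k J) = 0 := linear0 (tens u).
apply/subvP; rewrite subv_add; apply/andP; split; apply: tensv_sub => u v uR vS;
  rewrite memv_ker lfunE /= /h lext_tens; apply/eqP.
- by rewrite aR // t0l.
- by rewrite bS // t0r.
Qed.

(** For each first variable a there are two left-normed monomials,
    [[x_a, x_(a+1)], x_(a+2)] and [[x_a, x_(a+2)], x_(a+1)].  Their images under
    [first_var] and [bracket_diff] are, up to sign, (a, a+2) - (a, a) and
    (a, a+1) - (a, a+2); sending (a, a) and (a, a+1) to minus a monomial and
    (a, a+2) to 0 recovers the monomials, the sign of the second one being that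
    of [leib_map]. *)
Definition left_normed (p : 'I_3 * 'I_3) : seq (bool * ('I_3 * F1 * F1)) :=
  if p.2 == p.1 then [:: m1 true (p.1 + 2%:R) false false]
  else if p.2 == p.1 + 1 then [:: m1 true (p.1 + 1) false true] else [::].

(** The left-normed representative, computed in Perm (x) Lie: by construction it
    depends only on the class of [Phi (map3 leib_map y)]. *)
Definition normal_form (y : vec3 k F1) : vec3 k F1 :=
  lext (fun p => comb k (left_normed p))
    (lext (fun p => tens (signed_map k (fun=> false) first_var p.1)
                         (bracket_diff p.2))
      (Phi (map3 leib_map y))).

Fact normal_form_linear : linear normal_form.
Proof. by move=> a x y; rewrite /normal_form !linearP. Qed.
HB.instance Definition _ :=
  GRing.isLinear.Build k _ _ _ normal_form normal_form_linear.

Lemma normal_form_bvec (t : 'I_3 * F1 * F1) :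
  normal_form (bvec k t) =
  (-1) ^+ (t.1.2.2 (+) t.2.2) *:
   (comb k (left_normed (first_var t, t.1.1)) -
    comb k (left_normed (first_var t, t.1.1 + 1))).
Proof.
rewrite /normal_form comb1 /leib_map map3_comb Phi_comb /=.
rewrite (linear_comb (@linearP _ _ _ _ (lext _))) big_seq1 /= linearZ_LR /=.
rewrite lext_bvec /signed_map scale1r (linearB (tens _)) /= !tens_bvec.
rewrite linearB /= !lext_bvec.
by rewrite addbF; case: t => -[].
Qed.

(** On a left-normed monomial the difference is 0; on a monomial [x, [y, z]] it
    is a permutation of the Leibniz relator. *)
Lemma sub_normal_form y : y - normal_form y \in span3 [:: comb k leib_rel].
Proof.
have subE (I : finType) (t : I) (e : bool) A B :
    bvec k t - (-1) ^+ e *: (comb k A - comb k B) =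
    comb k ((false, t) :: [seq (~~ (x.1 (+) e), x.2) | x <- A] ++
                          [seq (x.1 (+) e, x.2) | x <- B]).
  rewrite comb1; apply: etrans (combD k [:: (false, t)] _); congr (_ + _).
  apply: etrans (combD k _ _); rewrite scalerBr opprB addrC -scalerN.
  rewrite combN /comb !big_map !scaler_sumr; congr (_ + _); apply: eq_bigr => x _ /=.
    by rewrite scalerA -signr_addb addbC addNb.
  by rewrite scalerA -signr_addb addbC.
have key t : bvec k t - normal_form (bvec k t) \in span3 [:: comb k leib_rel].
  rewrite normal_form_bvec subE; case: t => -[c [i0 i]] [j0 j].
  rewrite (ord1 i0) (ord1 j0) {i0 j0}; case: i.
    have [s s0 so] := perm3_ex c j.
    have s1 := perm3_affine s 1; have s2 := perm3_affine s 2%:R.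
    rewrite (_ : comb k _ = act3 s (comb k leib_rel)).
      by apply: span3_rel; rewrite mem_head.
    rewrite act3_free; apply: comb_perm; rewrite /= s1 s2 s0 so.
    by case: (ord3P c) => ->; case: j {so}.
  rewrite (comb_perm k
    (_ : perm_eq _ [:: m1 false c false j; m1 true c false j])).
    by rewrite /comb big_cons big_seq1 scale1r scaleN1r subrr mem0v.
  by case: (ord3P c) => ->; case: j.
have -> : normal_form y = \sum_t y t *: normal_form (bvec k t).
  by rewrite {1}[y]vec_sum linear_sum; apply: eq_bigr => t _; apply: linearZ.
rewrite {1}[y]vec_sum -sumrB; apply: rpred_sum => t _.
by rewrite -scalerBr; apply: rpredZ; apply: key.
Qed.

(** Let p0, p2, p1 be the monomials x(yz), (xy)z, (xz)y of Perm, and J the sum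
    j0 + j1 + j2 of the monomials of Lie.  The relator goes to
      - (p0 j0 + p2 j2 + p1 j1) = (p2 - p0) j0 + (p2 - p1) j1 - p2 J,
    where p2 - p0 and p2 - p1 are relations of Perm. *)
Lemma leib_white : map3 leib_map (comb k leib_rel) \in
  white_rels (presented [:: comb k perm_rel1; comb k perm_rel2])
             (presented [:: comb k jacobi_rel]).
Proof.
pose p0 := comb k [:: m1 false 0 true false]; pose j0 := comb k [:: br false 0].
pose p1 := comb k [:: m1 false 1 false true]; pose j1 := comb k [:: br false 1].
pose p2 := comb k [:: m1 false 2%:R false false].
pose j2 := comb k [:: br false 2%:R].
have PhiE : Phi (map3 leib_map (comb k leib_rel)) =
    - (tens p0 j0 + (tens p2 j2 + tens p1 j1)).
  rewrite map3_comb Phi_comb /p0 /p1 /p2 /j0 /j1 /j2 !tens_comb !combD combN.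
  exact: comb_perm.
have splitE (I J : finType) (x0 x1 x2 : vec k I) (y0 y1 y2 : vec k J) :
    - (tens x0 y0 + (tens x2 y2 + tens x1 y1)) =
    (tens (x2 - x0) y0 + tens (x2 - x1) y1) + tens x2 (- (y2 + (y0 + y1))).
  by apply/ffunP=> p; rewrite !ffunE; ring.
rewrite /white_rels -memv_preim lfunE /= PhiE splitE.
apply: memv_add; last first.
  apply: mem_tensv; rewrite ?memvf // rpredN.
  have -> : j2 + (j0 + j1) = comb k jacobi_rel by rewrite !combD.
  by apply: (@span3_gen k L1); rewrite mem_head.
have p20 : p2 - p0 = comb k perm_rel1 by rewrite /p2 /p0 combN combD.
have p21 : p2 - p1 =
    comb k perm_rel1 + comb k perm_rel2 - act3 xzy (comb k perm_rel1).
  (* Through x(zy): (xy)z = x(yz) = x(zy) = (xz)y. *)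
  pose q0 := comb k [:: m1 false 0 true true].
  have -> : act3 xzy (comb k perm_rel1) = p1 - q0.
    by rewrite act3_free combN combD /= !xzyE.
  have -> : comb k perm_rel2 = p0 - q0 by rewrite combN combD.
  by rewrite -p20 opprB !subrKA.
have r1 := span3_gen (mem_head (comb k perm_rel1) [:: comb k perm_rel2]).
have r1' := span3_stable xzy r1.
have r2 : comb k perm_rel2 \in span3 [:: comb k perm_rel1; comb k perm_rel2].
  by apply: span3_gen; rewrite !inE eqxx orbT.
by apply: rpredD; apply: mem_tensv;
  rewrite ?memvf // ?p20 ?p21 ?rpredB ?rpredD.
Qed.

Lemma Perm_Lie_Leib :
  operad_iso (quadratic_operad (white (Perm_data k) (Lie_data k)))
             (quadratic_operad (Leib_data k)).
Proof.
rewrite Perm_dataE Lie_dataE Leib_dataE.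
refine (@signed_presented_iso _ (white (presented _) (presented _)) F1 _ _
  leib_gen fst leib_map_s2map leib_genK leib_gen_invK _ _).
  by move=> r; rewrite inE => /eqP->; apply: leib_white.
apply/subvP=> x xR.
pose y := map3 (signed_map k (fun z : tens_module F1 L1 => z.1.2) fst) x.
have yK : map3 leib_map y = x.
  rewrite /y; move: x {xR y}.
  apply: lin_ext => [a u v|a u v|[[c i] j]]; rewrite ?linearP //.
  rewrite comb1 map3_comb /leib_map map3_comb /=; apply: comb_perm.
  by move: i j => [[a i] []] [[b j] []]; rewrite /= addbb.
rewrite -yK -[map3 _ _]lfunE memv_img //.
have := sub_normal_form y; rewrite /normal_form yK.
rewrite (white_rels_eval first_perm_rels bracket_diff_jacobi) //.
by rewrite ?linear0 ?addr0.
Qed.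

End Leibniz.

Theorem theorem20 (k : fieldType) (char0 : [pchar k]%R =i pred0) :
  [/\ operad_iso (quadratic_operad (black (PreLie_data k) (Com_data k)))
                 (quadratic_operad (Zinb_data k)),
      operad_iso (quadratic_operad (black (PreLie_data k) (As_data k)))
                 (quadratic_operad (Dend_data k))
    & operad_iso (quadratic_operad (white (Perm_data k) (Lie_data k)))
                 (quadratic_operad (Leib_data k))].
Proof.
split.
- exact: PreLie_Com_Zinb.
- exact: PreLie_As_Dend.
- exact: Perm_Lie_Leib.
Qed.
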